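(* Let $A,B,C$ be constants, $\nu=\frac{1}{2\sqrt A}\big(\frac{2B^2}{A}-\frac{\sqrt A}{2}-C\big)$, let $\theta$ be a solution of $\theta''(x)=(Ax^2+4Bx+2C)\theta(x)$, and consider the Fokker–Planck–Kolmogorov equation $\partial_tu=\tfrac12\partial_x^2u-\partial_x\big(\tfrac{\theta'}{\theta}u\big)$ of the diffusion $dX_t=\frac{\theta'(X_t)}{\theta(X_t)}dt+dW_t$. Any Lie symmetry $u(x,t)=f(x,t)\,\mathcal U(\mathcal X(x,t),\mathcal T(t))$ of this equation such that $\mathcal T(0)=0$ is one of the following two-parametric symmetries (with parameters $\alpha,\beta$) or a composition of them: $$\mathbf s_1^{\alpha,\beta}:\quad \frac{u(x,t)}{\mathcal U(\mathcal X_1,\mathcal T_1)}=\frac{\theta(x)}{\theta(\mathcal X_1)}\;\frac{\exp\!\left(-\frac{\sqrt A\,(x+2B/A)^2\,[(\beta+1)\mathcal T_+-(\alpha+1)\mathcal T_-]}{2\mathcal T_+\mathcal T_-}\right)}{\mathcal T_+^{-\nu}\,\mathcal T_-^{\nu-1/2}},$$ $$\mathbf s_2^{\alpha,\beta}:\quad \frac{u(x,t)}{\mathcal U(\mathcal X_2,t)}=\frac{\theta(x)}{\theta(\mathcal X_2)}\, \frac{\exp\!\big(-\frac{\sqrt A}{2}(\alpha e^{\sqrt At}-\beta e^{-\sqrt At})[x+2B/A]\big)}{\exp\!\big(\frac{\sqrt A}{2}(\alpha e^{\sqrt At}-\beta e^{-\sqrt At})[\mathcal X_2+2B/A]\big)},$$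 where $$\mathcal T_-=\beta+1+\alpha e^{-2\sqrt At},\qquad \mathcal T_+=\alpha+1+\beta e^{2\sqrt At},\qquad \mathcal T_1=t+\frac{\ln(\mathcal T_-/\mathcal T_+)}{2\sqrt A},$$ $$\mathcal X_1=\frac{(x+2B/A)\sqrt{\alpha+\beta+1}}{\sqrt{\mathcal T_+\mathcal T_-}}-\frac{2B}{A},\qquad \mathcal X_2=x-\alpha e^{\sqrt At}-\beta e^{-\sqrt At}.$$
   Context: $W$ is a standard Brownian motion. A vector field $\mathbf v=\xi\partial_x+\tau\partial_t+\varphi\partial_u$ generates a local group of symmetries of the PDE if its second prolongation annihilates the equation on solutions; Lie symmetries are the transformations of solutions obtained by exponentiating such vector fields. Writing one as $u(x,t)=f(x,t)\,\mathcal U(\mathcal X(x,t),\mathcal T(t))$ means that for any solution $\mathcal U$ of the equation the function $u$ is again a solution.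
   Formalization: The power of T_- in the denominator of s_1 is corrected from ν−1/2 to ν+1/2 (as printed, s_1 is a symmetry only for α=0 and the claim fails); A>0 is assumed, and θ has no zero on the state interval, so that the formulas are real and defined. *)

(* Defs.v *)
From Stdlib Require Import Reals List.
From Coquelicot Require Import Coquelicot.
Open Scope R_scope.

(** * The equation *)

(* [theta] is a solution on all of [R] (the equation is linear, so every local
   solution extends).  It may have zeros; the diffusion then lives on an open
   interval [between a b] on which it has none. *)
Definition theta_equation (A B C : R) (theta : R -> R) : Prop :=
  forall x,
    ex_derive theta x /\
    is_derive (Derive theta) x ((A * x ^ 2 + 4 * B * x + 2 * C) * theta x).

Definition between (a b : Rbar) (x : R) : Prop := Rbar_lt a x /\ Rbar_lt x b.

Definition drift (theta : R -> R) (x : R) : R := Derive theta x / theta x.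

(* Classical C^{2,1} solutions on an open set [Om] of the (x,t)-plane. *)
Definition solution_on (theta : R -> R) (Om : R * R -> Prop) (U : R -> R -> R)
  : Prop :=
  let Ux := fun x t => Derive (fun y => U y t) x in
  let Uxx := fun x t => Derive (fun y => Ux y t) x in
  let Ut := fun x t => Derive (fun s => U x s) t in
  forall x t, Om (x, t) ->
    ex_derive (fun y => U y t) x /\
    ex_derive (fun y => Ux y t) x /\
    ex_derive (fun s => U x s) t /\
    continuous (fun p : R * R => Ux (fst p) (snd p)) (x, t) /\
    continuous (fun p : R * R => Uxx (fst p) (snd p)) (x, t) /\
    continuous (fun p : R * R => Ut (fst p) (snd p)) (x, t) /\
    Ut x t = / 2 * Uxx x t - Derive (fun y => drift theta y * U y t) x.

(** * Vector fields and their prolongation *)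

(* [xi d/dx + tau d/dt + phi d/du], coefficients as functions of x, t, u. *)
Record vfield := VField {
  xi : R -> R -> R -> R;
  tau : R -> R -> R -> R;
  phi : R -> R -> R -> R }.

Definition dx (f : R -> R -> R -> R) (x t u : R) := Derive (fun y => f y t u) x.
Definition dt (f : R -> R -> R -> R) (x t u : R) := Derive (fun s => f x s u) t.
Definition du (f : R -> R -> R -> R) (x t u : R) := Derive (fun w => f x t w) u.

(* [f] is of class C^n on the set of (x,t,u) with [I x]. *)
Fixpoint class_C (n : nat) (I : R -> Prop) (f : R -> R -> R -> R) : Prop :=
  (forall x t u, I x ->
     continuous (fun p : R * R * R => f (fst (fst p)) (snd (fst p)) (snd p))
                (x, t, u)) /\
  match n with
  | O => True
  | S m =>
      (forall x t u, I x ->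
         ex_derive (fun y => f y t u) x /\
         ex_derive (fun s => f x s u) t /\
         ex_derive (fun w => f x t w) u) /\
      class_C m I (dx f) /\ class_C m I (dt f) /\ class_C m I (du f)
  end.

Definition smooth (I : R -> Prop) (v : vfield) : Prop :=
  forall n, class_C n I (xi v) /\ class_C n I (tau v) /\ class_C n I (phi v).

(* Functions on the first and second jet spaces; the coordinates are, in order,
   x t u ux ut  and  x t u ux ut uxx uxt utt. *)
Definition jet1fun := R -> R -> R -> R -> R -> R.
Definition jet2fun := R -> R -> R -> R -> R -> R -> R -> R -> R.

(* Total derivatives of functions of (x,t,u). *)
Definition Dx0 (f : R -> R -> R -> R) (x t u ux : R) := dx f x t u + ux * du f x t u.
Definition Dt0 (f : R -> R -> R -> R) (x t u ut : R) := dt f x t u + ut * du f x t u.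

(* Total derivatives of functions on the first jet space. *)
Definition Dx1 (F : jet1fun) : jet2fun := fun x t u ux ut uxx uxt _ =>
  Derive (fun z => F z t u ux ut) x + ux * Derive (fun z => F x t z ux ut) u
  + uxx * Derive (fun z => F x t u z ut) ux + uxt * Derive (fun z => F x t u ux z) ut.
Definition Dt1 (F : jet1fun) : jet2fun := fun x t u ux ut _ uxt utt =>
  Derive (fun z => F x z u ux ut) t + ut * Derive (fun z => F x t z ux ut) u
  + uxt * Derive (fun z => F x t u z ut) ux + utt * Derive (fun z => F x t u ux z) ut.

(* Coefficients of the prolonged field, by the recursion
   phi^{J,k} = D_k phi^J - (D_k xi) u_{J,x} - (D_k tau) u_{J,t}. *)
Definition phi_x (v : vfield) : jet1fun := fun x t u ux ut =>
  Dx0 (phi v) x t u ux - ux * Dx0 (xi v) x t u ux - ut * Dx0 (tau v) x t u ux.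
Definition phi_t (v : vfield) : jet1fun := fun x t u ux ut =>
  Dt0 (phi v) x t u ut - ux * Dt0 (xi v) x t u ut - ut * Dt0 (tau v) x t u ut.
Definition phi_xx (v : vfield) : jet2fun := fun x t u ux ut uxx uxt utt =>
  Dx1 (phi_x v) x t u ux ut uxx uxt utt
  - uxx * Dx0 (xi v) x t u ux - uxt * Dx0 (tau v) x t u ux.
Definition phi_xt (v : vfield) : jet2fun := fun x t u ux ut uxx uxt utt =>
  Dt1 (phi_x v) x t u ux ut uxx uxt utt
  - uxx * Dt0 (xi v) x t u ut - uxt * Dt0 (tau v) x t u ut.
Definition phi_tt (v : vfield) : jet2fun := fun x t u ux ut uxx uxt utt =>
  Dt1 (phi_t v) x t u ux ut uxx uxt utt
  - uxt * Dt0 (xi v) x t u ut - utt * Dt0 (tau v) x t u ut.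

(* The second prolongation of [v], applied to [F]. *)
Definition pr2 (v : vfield) (F : jet2fun) : jet2fun :=
  fun x t u ux ut uxx uxt utt =>
    xi v x t u * Derive (fun z => F z t u ux ut uxx uxt utt) x
  + tau v x t u * Derive (fun z => F x z u ux ut uxx uxt utt) t
  + phi v x t u * Derive (fun z => F x t z ux ut uxx uxt utt) u
  + phi_x v x t u ux ut * Derive (fun z => F x t u z ut uxx uxt utt) ux
  + phi_t v x t u ux ut * Derive (fun z => F x t u ux z uxx uxt utt) ut
  + phi_xx v x t u ux ut uxx uxt utt
      * Derive (fun z => F x t u ux ut z uxt utt) uxx
  + phi_xt v x t u ux ut uxx uxt utt
      * Derive (fun z => F x t u ux ut uxx z utt) uxt
  + phi_tt v x t u ux ut uxx uxt utt
      * Derive (fun z => F x t u ux ut uxx uxt z) utt.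

(* The equation as a function on the second jet space, with the product
   d/dx (drift * u) expanded. *)
Definition fpk (theta : R -> R) : jet2fun := fun x _ u ux ut uxx _ _ =>
  ut - (/ 2 * uxx - (Derive (drift theta) x * u + drift theta x * ux)).

Definition infinitesimal_symmetry (theta : R -> R) (I : R -> Prop) (v : vfield)
  : Prop :=
  smooth I v /\
  forall x t u ux ut uxx uxt utt, I x ->
    fpk theta x t u ux ut uxx uxt utt = 0 ->
    pr2 v (fpk theta) x t u ux ut uxx uxt utt = 0.

(** * Lie symmetries *)

(* [q] is the image of [p] under exp(v), the time-1 flow of [v] on the space of
   (x,t,u) with [I x].  The flow of [v] at time eps is the time-1 flow of
   [eps v], so no flow parameter is needed. *)
Definition exp_maps (I : R -> Prop) (v : vfield) (p q : R * R * R) : Prop :=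
  exists cx ct cu : R -> R,
    (cx 0, ct 0, cu 0) = p /\ (cx 1, ct 1, cu 1) = q /\
    forall s, 0 <= s <= 1 ->
      I (cx s) /\
      is_derive cx s (xi v (cx s) (ct s) (cu s)) /\
      is_derive ct s (tau v (cx s) (ct s) (cu s)) /\
      is_derive cu s (phi v (cx s) (ct s) (cu s)).

(* Successive application of exp(v1), exp(v2), ... *)
Fixpoint exps_map (I : R -> Prop) (vs : list vfield) (p q : R * R * R) : Prop :=
  match vs with
  | nil => p = q
  | v :: vs' => exists r, exp_maps I v p r /\ exps_map I vs' r q
  end.

(* The transformation U |-> u,  u(x,t) = multiplier(x,t) U(space(x,t), time(t)). *)
Record transf := Transf {
  multiplier : R -> R -> R;
  space : R -> R -> R;
  time : R -> R }.

Definition apply (g : transf) (U : R -> R -> R) : R -> R -> R :=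
  fun x t => multiplier g x t * U (space g x t) (time g t).

(* [apply (comp g h) U] is [apply g (apply h U)]. *)
Definition comp (g h : transf) : transf := Transf
  (fun x t => multiplier g x t * multiplier h (space g x t) (time g t))
  (fun x t => space h (space g x t) (time g t))
  (fun t => time h (time g t)).

Definition idt : transf := Transf (fun _ _ => 1) (fun x _ => x) (fun t => t).

Definition open_in_strip (I : R -> Prop) (Om : R * R -> Prop) : Prop :=
  open Om /\ forall p, Om p -> I (fst p).

(* [g], restricted to (x,t) in [D], turns solutions into solutions. *)
Definition symmetry_on (theta : R -> R) (I : R -> Prop) (D : R * R -> Prop)
  (g : transf) : Prop :=
  (forall x t, D (x, t) -> I x /\ I (space g x t)) /\
  forall (Om : R * R -> Prop) (U : R -> R -> R),
    open_in_strip I Om -> solution_on theta Om U ->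
    solution_on theta
      (fun p => D p /\ Om (space g (fst p) (snd p), time g (snd p))) (apply g U).

(* A Lie symmetry written u = f U(X,T): on the graph of any solution U, the
   exponentials of finitely many infinitesimal symmetries carry the point above
   (X(x,t), T(t)) to the point of the graph of u above (x,t). *)
Definition lie_symmetry_on (theta : R -> R) (I : R -> Prop) (D : R * R -> Prop)
  (g : transf) : Prop :=
  symmetry_on theta I D g /\
  exists vs : list vfield,
    (forall v, In v vs -> infinitesimal_symmetry theta I v) /\
    forall (Om : R * R -> Prop) (U : R -> R -> R),
      open_in_strip I Om -> solution_on theta Om U ->
      forall x t, D (x, t) -> Om (space g x t, time g t) ->
        exps_map I vs
          (space g x t, time g t, U (space g x t) (time g t))
          (x, t, apply g U x t).

(** * The two explicit families *)

Definition nu (A B C : R) : R :=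
  1 / (2 * sqrt A) * (2 * B ^ 2 / A - sqrt A / 2 - C).

Definition Tminus (A alpha beta t : R) : R :=
  beta + 1 + alpha * exp (- 2 * sqrt A * t).
Definition Tplus (A alpha beta t : R) : R :=
  alpha + 1 + beta * exp (2 * sqrt A * t).

Definition T1 (A alpha beta t : R) : R :=
  t + ln (Tminus A alpha beta t / Tplus A alpha beta t) / (2 * sqrt A).
Definition X1 (A B alpha beta x t : R) : R :=
  (x + 2 * B / A) * sqrt (alpha + beta + 1)
    / sqrt (Tplus A alpha beta t * Tminus A alpha beta t) - 2 * B / A.

(* The power of [Tminus] is [nu + 1/2]; with [nu - 1/2] this would be a symmetry
   only for [alpha = 0].  Indeed [T1' = (alpha+beta+1) / (Tplus Tminus)], and the
   prefactor is, up to a constant, [T1'^(1/4) exp(k (t - T1))] with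
   [k = 2B^2/A - C = 2 sqrt A (nu + 1/4)], that is
   [Tplus^nu * Tminus^(-nu-1/2)]. *)
Definition s1 (A B C : R) (theta : R -> R) (alpha beta : R) : transf := Transf
  (fun x t =>
     theta x / theta (X1 A B alpha beta x t) *
     (exp (- (sqrt A * (x + 2 * B / A) ^ 2 *
              ((beta + 1) * Tplus A alpha beta t
               - (alpha + 1) * Tminus A alpha beta t)
              / (2 * Tplus A alpha beta t * Tminus A alpha beta t)))
      / (Rpower (Tplus A alpha beta t) (- nu A B C)
         * Rpower (Tminus A alpha beta t) (nu A B C + 1 / 2))))
  (X1 A B alpha beta)
  (T1 A alpha beta).

Definition X2 (A alpha beta x t : R) : R :=
  x - alpha * exp (sqrt A * t) - beta * exp (- sqrt A * t).

Definition s2 (A B : R) (theta : R -> R) (alpha beta : R) : transf :=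
  let p := fun t =>
    sqrt A / 2 * (alpha * exp (sqrt A * t) - beta * exp (- sqrt A * t)) in
  Transf
  (fun x t =>
     theta x / theta (X2 A alpha beta x t) *
     (exp (- p t * (x + 2 * B / A))
      / exp (p t * (X2 A alpha beta x t + 2 * B / A))))
  (X2 A alpha beta)
  (fun t => t).

Inductive letter := L1 (alpha beta : R) | L2 (alpha beta : R).

Definition letter_transf (A B C : R) (theta : R -> R) (l : letter) : transf :=
  match l with
  | L1 alpha beta => s1 A B C theta alpha beta
  | L2 alpha beta => s2 A B theta alpha beta
  end.

(* The times at which the roots, powers and logarithm are those of positive
   numbers.  At t = 0 all the conditions reduce to 0 < alpha + beta + 1. *)
Definition letter_time (A : R) (l : letter) (t : R) : Prop :=
  match l with
  | L1 alpha beta =>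
      0 < alpha + beta + 1 /\ 0 < Tplus A alpha beta t /\ 0 < Tminus A alpha beta t
  | L2 _ _ => True
  end.

Definition letter_dom (A B C : R) (theta : R -> R) (I : R -> Prop) (l : letter)
  (p : R * R) : Prop :=
  letter_time A l (snd p) /\ I (fst p) /\
  I (space (letter_transf A B C theta l) (fst p) (snd p)).

Fixpoint word_transf (A B C : R) (theta : R -> R) (w : list letter) : transf :=
  match w with
  | nil => idt
  | l :: w' => comp (letter_transf A B C theta l) (word_transf A B C theta w')
  end.

Fixpoint word_time (A B C : R) (theta : R -> R) (w : list letter) (t : R) : Prop :=
  match w with
  | nil => True
  | l :: w' =>
      letter_time A l t /\
      word_time A B C theta w' (time (letter_transf A B C theta l) t)
  end.

(* No division by zero in the factors theta(.)/theta(.) of the composition: every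
   point of the x-orbit of (x,t) along the word avoids the zeros of [theta].  As
   these zeros are isolated and the intermediate points are strictly increasing
   in x, this can fail only for isolated x at each t. *)
Fixpoint word_regular (A B C : R) (theta : R -> R) (w : list letter) (x t : R)
  : Prop :=
  match w with
  | nil => True
  | l :: w' =>
      theta (space (letter_transf A B C theta l) x t) <> 0 /\
      word_regular A B C theta w'
        (space (letter_transf A B C theta l) x t)
        (time (letter_transf A B C theta l) t)
  end.

(* Main.v *)
Require Import Defs.
From Stdlib Require Import Reals List Lra.
From Coquelicot Require Import Coquelicot.
Open Scope R_scope.

(** Dividing a solution by [theta] turns the Fokker-Planck-Kolmogorov equation into
    that of the oscillator [w_t = w_xx / 2 - (A x ^ 2 + 4 B x + 2 C) w / 2], because
    the drift is the logarithmic derivative of [theta] and its Riccati equation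
    removes the first-order term ([fpk_to_oscillator], [oscillator_to_fpk]). Up to
    the factor [theta(x) / theta(X)] everything therefore happens for the quadratic
    potential, centred at [y = x + 2 B / A] and with a constant
    [k = 2 B ^ 2 / A - C].

    That the two families are symmetries is the computation of the Gaussian
    substitutions [w = exp (a2 y ^ 2 + a1 y + a0) W (sg y + s - 2 B / A, T)]: they
    preserve the oscillator when six ordinary differential equations hold
    ([oscillator_symmetry]), and the coefficients of [s1] and [s2] solve them.

    For the converse, the determining equations of the second prolongation are
    solved: [tau] is a combination of [1], [w ^ 2] and [w ^ -2] with
    [w = exp (sqrt A t)], [xi] adds to [tau' y / 2] a combination of [w] and
    [1 / w], and [phi] is determined up to a constant multiple of [u] and an
    inhomogeneous term ([symmetry_generator]). The flow of such a field is not
    linear, but it is in the coordinates [p = l w ^ 2], [q = l], [r = l w y]: there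
    [(p, q)] moves by a one-parameter subgroup of SL(2) and [r] is shifted by a
    linear combination of [p] and [q] ([flow_carries]). The multiplier is the
    exponential of an explicit generating function of this affine map
    ([log_multiplier], [flow_log_multiplier]). Because the latter depends only on
    the accumulated map and on the end points, a finite sequence of exponentials is
    described by a single [oscillator_map] ([exps_map_carries]).

    The inhomogeneous term drops out of the difference of two curves above the same
    base curve; applied to the solutions [0] and [theta ^ 2] this identifies the
    multiplier [f]. Finally [T 0 = 0] says that the Moebius map of [w ^ 2] fixes [1],
    which is exactly the normalisation of [s1]; the shift of [r] is an [s2], and the
    remaining constant factor, always positive, is a commutator of two shifts, since
    these generate a Heisenberg group ([canonical_word_represents]). *)

(** * Linear ordinary differential equations *)

Ltac known_derive :=
  repeat match goal with
  | H : is_derive ?f ?x ?l |- context [Derive ?g ?x] =>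
      lazymatch l with
      | Derive g x => fail
      | _ => replace (Derive g x) with l by (symmetry; apply is_derive_unique; exact H)
      end
  end.

Ltac known_ex_derive :=
  repeat split;
  try match goal with
  | |- ex_derive ?g ?x =>
      match goal with
      | H : is_derive _ x ?l |- _ => exists l; exact H
      end
  end.

Ltac derive := auto_derive; [known_ex_derive | known_derive].

Lemma is_derive_continuous (f : R -> R) (x l : R) :
  is_derive f x l -> continuous f x.
Proof.
  intros h. apply (ex_derive_continuous (K := R_AbsRing) (V := R_NormedModule)).
  exists l. exact h.
Qed.

Lemma antiderivative (f : R -> R) :
  (forall x, continuous f x) ->
  exists F : R -> R, F 0 = 0 /\ forall x, is_derive F x (f x).
Proof.
  intros hf. exists (RInt f 0). split.
  - exact (RInt_point 0 f).
  - intros x. apply (is_derive_RInt f (RInt f 0) 0).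
    + apply filter_forall. intros y. apply (RInt_correct (V := R_CompleteNormedModule)).
      apply (ex_RInt_continuous (V := R_CompleteNormedModule)). intros; apply hf.
    + apply hf.
Qed.

Lemma constant_on_unit (f : R -> R) :
  (forall s, 0 <= s <= 1 -> is_derive f s 0) ->
  forall s, 0 <= s <= 1 -> f s = f 0.
Proof.
  intros hf s hs. destruct (Req_dec s 0) as [-> | hne]; [reflexivity |].
  symmetry. apply eq_is_derive; [| lra].
  intros t ht. apply hf. lra.
Qed.

(** A coefficient known only on [0,1] is extended to [R] by freezing it outside,
    which makes its antiderivative differentiable at the end points too. *)
Lemma scalar_linear_ode (y g : R -> R) :
  (forall s, 0 <= s <= 1 -> continuous g s) ->
  (forall s, 0 <= s <= 1 -> is_derive y s (g s * y s)) ->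
  exists G : R -> R, forall s, 0 <= s <= 1 -> y s = y 0 * exp (G s).
Proof.
  intros hg hy.
  set (clamp := fun s => / 2 * (1 + Rabs s - Rabs (s - 1))).
  assert (hclamp : forall s, 0 <= clamp s <= 1).
  { intros s. unfold clamp, Rabs. destruct (Rcase_abs s), (Rcase_abs (s - 1)); lra. }
  assert (hid : forall s, 0 <= s <= 1 -> clamp s = s).
  { intros s hs. unfold clamp, Rabs. destruct (Rcase_abs s), (Rcase_abs (s - 1)); lra. }
  assert (hc : forall s, continuous clamp s).
  { intros s. unfold clamp.
    apply (continuous_mult (fun _ => / 2)); [apply continuous_const |].
    apply (continuous_minus (fun s => 1 + Rabs s) (fun s => Rabs (s - 1))).
    - apply (continuous_plus (fun _ => 1) Rabs);
        [apply continuous_const | apply continuous_Rabs].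
    - apply (continuous_comp (fun s => s - 1) Rabs); [| apply continuous_Rabs].
      apply (continuous_minus (fun s => s) (fun _ => 1));
        [apply continuous_id | apply continuous_const]. }
  destruct (antiderivative (fun s => g (clamp s))) as [G [G0 hG]].
  { intros s. apply (continuous_comp clamp g); auto. }
  exists G. intros s hs.
  assert (H : y s * exp (- G s) = y 0 * exp (- G 0)).
  { apply (constant_on_unit (fun s => y s * exp (- G s))); [| exact hs].
    intros r hr. specialize (hG r). specialize (hy r hr).
    rewrite (hid r hr) in hG. derive. ring. }
  rewrite G0, Ropp_0, exp_0, Rmult_1_r in H.
  rewrite <- H, Rmult_assoc, <- exp_plus, Rplus_opp_l, exp_0. ring.
Qed.

Lemma constant_on_line (f : R -> R) :
  (forall t, is_derive f t 0) -> forall t, f t = f 0.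
Proof.
  intros hf t. destruct (Rtotal_order t 0) as [h | [-> | h]]; [| reflexivity |].
  - apply eq_is_derive; auto.
  - symmetry. apply eq_is_derive; auto.
Qed.

Lemma hyperbolic_ode (kappa : R) (f f' : R -> R) :
  0 < kappa ->
  (forall t, is_derive f t (f' t)) ->
  (forall t, is_derive f' t (kappa ^ 2 * f t)) ->
  exists p q, forall t,
    f t = p * exp (kappa * t) + q * exp (- kappa * t) /\
    f' t = kappa * (p * exp (kappa * t) - q * exp (- kappa * t)).
Proof.
  intros hk hf hf'.
  assert (H1 := constant_on_line (fun t => (f' t + kappa * f t) * exp (- kappa * t))).
  assert (H2 := constant_on_line (fun t => (f' t - kappa * f t) * exp (kappa * t))).
  cbv beta in H1, H2. rewrite Rmult_0_r, exp_0 in H1. rewrite Rmult_0_r, exp_0 in H2.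
  exists ((f' 0 + kappa * f 0) / (2 * kappa)), ((kappa * f 0 - f' 0) / (2 * kappa)).
  intros t.
  assert (E : exp (- kappa * t) * exp (kappa * t) = 1).
  { rewrite <- exp_plus, <- exp_0. f_equal. ring. }
  specialize (H1 ltac:(intros r; specialize (hf r); specialize (hf' r); derive; ring) t).
  specialize (H2 ltac:(intros r; specialize (hf r); specialize (hf' r); derive; ring) t).
  set (e := exp (kappa * t)) in *. set (e' := exp (- kappa * t)) in *.
  assert (F1 : f' t + kappa * f t = (f' 0 + kappa * f 0) * e).
  { transitivity ((f' t + kappa * f t) * (e' * e)); [rewrite E; ring |].
    rewrite <- Rmult_assoc, H1. ring. }
  assert (F2 : f' t - kappa * f t = (f' 0 - kappa * f 0) * e').
  { transitivity ((f' t - kappa * f t) * (e' * e)); [rewrite E; ring |].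
    rewrite (Rmult_comm e' e), <- Rmult_assoc, H2. ring. }
  split.
  - apply (Rmult_eq_reg_l (2 * kappa)); [| lra]. field_simplify; [lra | lra].
  - apply (Rmult_eq_reg_l 2); [| lra]. field_simplify; [lra | lra].
Qed.

(** The entries of [exp (s N)] for a traceless [2 x 2] matrix [N], for which
    [N ^ 2 = delta]: the exponential is [C s + S s * N]. *)
Lemma exp_traceless (delta : R) :
  exists C S : R -> R, C 0 = 1 /\ S 0 = 0 /\
    (forall s, is_derive C s (delta * S s)) /\ (forall s, is_derive S s (C s)).
Proof.
  destruct (Rtotal_order delta 0) as [h | [-> | h]].
  - set (k := sqrt (- delta)).
    assert (hk : 0 < k) by (apply sqrt_lt_R0; lra).
    assert (hk2 : k * k = - delta) by (apply sqrt_sqrt; lra).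
    exists (fun s => cos (k * s)), (fun s => sin (k * s) / k).
    split; [| split; [| split]]; try intros s.
    + rewrite Rmult_0_r. apply cos_0.
    + rewrite Rmult_0_r, sin_0. field. lra.
    + auto_derive; [trivial |]. replace delta with (- (k * k)) by lra. field. lra.
    + auto_derive; [trivial |]. field. lra.
  - exists (fun _ => 1), (fun s => s).
    split; [reflexivity | split; [reflexivity | split]]; intros s;
      auto_derive; trivial; ring.
  - set (k := sqrt delta).
    assert (hk : 0 < k) by (apply sqrt_lt_R0; lra).
    assert (hk2 : k * k = delta) by (apply sqrt_sqrt; lra).
    exists (fun s => / 2 * (exp (k * s) + exp (- k * s))),
      (fun s => (exp (k * s) - exp (- k * s)) / (2 * k)).
    split; [| split; [| split]]; try intros s.
    + rewrite !Rmult_0_r, exp_0. lra.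
    + rewrite !Rmult_0_r, exp_0. field. lra.
    + auto_derive; [trivial |]. rewrite <- hk2. field. lra.
    + auto_derive; [trivial |]. field. lra.
Qed.

Lemma planar_linear_ode (n11 n12 n21 p0 q0 : R) :
  exists p q : R -> R, p 0 = p0 /\ q 0 = q0 /\
    (forall s, is_derive p s (n11 * p s + n12 * q s)) /\
    (forall s, is_derive q s (n21 * p s - n11 * q s)).
Proof.
  destruct (exp_traceless (n11 ^ 2 + n12 * n21)) as [C [S [C0 [S0 [hC hS]]]]].
  exists (fun s => C s * p0 + S s * (n11 * p0 + n12 * q0)),
    (fun s => C s * q0 + S s * (n21 * p0 - n11 * q0)).
  rewrite C0, S0. split; [ring | split; [ring | split]]; intros s;
    specialize (hC s); specialize (hS s); derive; ring.
Qed.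

(** * Determining equations of the infinitesimal symmetries *)

Definition potential (A B C x : R) : R := A * x ^ 2 + 4 * B * x + 2 * C.

Lemma locally_between (a b : Rbar) (x : R) :
  between a b x -> locally x (between a b).
Proof. intros [h1 h2]. apply (locally_interval _ x a b); auto. split; auto. Qed.

Lemma between_convex (a b : Rbar) (x y z : R) :
  between a b x -> between a b y -> x <= z <= y -> between a b z.
Proof.
  intros [h1 h2] [h3 h4] [h5 h6]. split.
  - apply Rbar_lt_le_trans with x; auto.
  - apply Rbar_le_lt_trans with y; auto.
Qed.

Lemma constant_on_between (a b : Rbar) (f : R -> R) :
  (forall x, between a b x -> is_derive f x 0) ->
  forall x y, between a b x -> between a b y -> f x = f y.
Proof.
  intros hf.
  assert (hlt : forall x y, between a b x -> between a b y -> x < y -> f x = f y).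
  { intros x y hx hy hxy. apply eq_is_derive; [| exact hxy].
    intros z hz. apply hf. apply (between_convex a b x y); auto. }
  intros x y hx hy. destruct (Rtotal_order x y) as [h | [-> | h]];
    [apply hlt | reflexivity | symmetry; apply hlt]; auto.
Qed.

Lemma theta_derive (A B C : R) (theta : R -> R) (x : R) :
  theta_equation A B C theta ->
  is_derive theta x (Derive theta x) /\
  is_derive (Derive theta) x (potential A B C x * theta x).
Proof.
  intros h. destruct (h x) as [h1 h2]. split; [| exact h2].
  apply Derive_correct, h1.
Qed.

(** Riccati form of the equation of [theta]. *)
Lemma drift_derive (A B C : R) (theta : R -> R) (x : R) :
  theta_equation A B C theta -> theta x <> 0 ->
  is_derive (drift theta) x (potential A B C x - drift theta x ^ 2).
Proof.
  intros h h0. destruct (theta_derive A B C theta x h) as [h1 h2].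
  unfold drift. auto_derive; [known_ex_derive; auto |].
  known_derive. field. exact h0.
Qed.

Lemma drift_derive2 (A B C : R) (theta : R -> R) (a b : Rbar) (x : R) :
  theta_equation A B C theta -> (forall y, between a b y -> theta y <> 0) ->
  between a b x ->
  is_derive (Derive (drift theta)) x
    (2 * A * x + 4 * B
     - 2 * drift theta x * (potential A B C x - drift theta x ^ 2)).
Proof.
  intros h h0 hx.
  apply (is_derive_ext_loc (fun y => potential A B C y - drift theta y ^ 2)).
  - apply (filter_imp (between a b)); [| apply locally_between, hx].
    intros y hy. symmetry. apply is_derive_unique, drift_derive; auto.
  - assert (h1 := drift_derive A B C theta x h (h0 x hx)).
    unfold potential. auto_derive; [known_ex_derive |]. known_derive.
    unfold potential. ring.
Qed.

Lemma class_C_derive (n : nat) (I : R -> Prop) (f : R -> R -> R -> R) :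
  class_C (S n) I f ->
  (forall x t u, I x ->
     is_derive (fun y => f y t u) x (dx f x t u) /\
     is_derive (fun s => f x s u) t (dt f x t u) /\
     is_derive (fun w => f x t w) u (du f x t u)) /\
  class_C n I (dx f) /\ class_C n I (dt f) /\ class_C n I (du f).
Proof.
  intros [_ [h1 h2]]. split; [| exact h2].
  intros x t u hx. destruct (h1 x t u hx) as [h3 [h4 h5]].
  split; [| split]; apply Derive_correct; assumption.
Qed.

Lemma Derive_phi_x (a b c d e f : R -> R) (x k l : R) (a' b' c' d' e' f' : R) :
  is_derive a x a' -> is_derive b x b' -> is_derive c x c' ->
  is_derive d x d' -> is_derive e x e' -> is_derive f x f' ->
  Derive (fun z => a z + k * b z - k * (c z + k * d z) - l * (e z + k * f z)) x
  = a' + k * b' - k * (c' + k * d') - l * (e' + k * f').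
Proof.
  intros. apply is_derive_unique. auto_derive.
  - repeat split; eexists; eassumption.
  - known_derive. ring.
Qed.

(** The prolonged equation in terms of the partial derivatives of the coefficients;
    the determining equations are its coefficients as a polynomial in the jet
    variables, once [ut] is eliminated. The mixed derivatives of [phi] in the two
    orders are kept apart, as only the dependence on [u] found later identifies
    them. *)
Lemma pr2_fpk (A B C : R) (theta : R -> R) (a b : Rbar) (v : vfield)
  (x t u ux ut uxx uxt utt : R) :
  theta_equation A B C theta -> (forall y, between a b y -> theta y <> 0) ->
  smooth (between a b) v -> between a b x ->
  let V := potential A B C x in
  let mu := drift theta x in
  let p := fun f : R -> R -> R -> R => f x t u in
  pr2 v (fpk theta) x t u ux ut uxx uxt utt =
  p (xi v) * ((2 * A * x + 4 * B - 2 * mu * (V - mu ^ 2)) * u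
              + (V - mu ^ 2) * ux)
  + p (phi v) * (V - mu ^ 2)
  + mu * (p (dx (phi v)) + ux * p (du (phi v))
          - ux * (p (dx (xi v)) + ux * p (du (xi v)))
          - ut * (p (dx (tau v)) + ux * p (du (tau v))))
  + (p (dt (phi v)) + ut * p (du (phi v))
     - ux * (p (dt (xi v)) + ut * p (du (xi v)))
     - ut * (p (dt (tau v)) + ut * p (du (tau v))))
  - / 2 * (p (dx (dx (phi v))) + ux * p (dx (du (phi v)))
           - ux * (p (dx (dx (xi v))) + ux * p (dx (du (xi v))))
           - ut * (p (dx (dx (tau v))) + ux * p (dx (du (tau v))))
           + ux * (p (du (dx (phi v))) + ux * p (du (du (phi v)))
                   - ux * (p (du (dx (xi v))) + ux * p (du (du (xi v))))
                   - ut * (p (du (dx (tau v))) + ux * p (du (du (tau v)))))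
           + uxx * (p (du (phi v)) - 2 * p (dx (xi v)) - 3 * ux * p (du (xi v))
                    - ut * p (du (tau v)))
           - 2 * uxt * (p (dx (tau v)) + ux * p (du (tau v)))).
Proof.
  intros hth h0 hv hx V mu p.
  destruct (hv 2%nat) as [h1 [h2 h3]].
  apply class_C_derive in h1. destruct h1 as [_ [h1x [_ h1u]]].
  apply class_C_derive in h2. destruct h2 as [_ [h2x [_ h2u]]].
  apply class_C_derive in h3. destruct h3 as [_ [h3x [_ h3u]]].
  apply class_C_derive in h1x, h2x, h3x, h1u, h2u, h3u.
  destruct h1x as [h1x _], h2x as [h2x _], h3x as [h3x _],
    h1u as [h1u _], h2u as [h2u _], h3u as [h3u _].
  destruct (h1x x t u hx) as [h1xx [_ h1xu]].
  destruct (h2x x t u hx) as [h2xx [_ h2xu]].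
  destruct (h3x x t u hx) as [h3xx [_ h3xu]].
  destruct (h1u x t u hx) as [h1ux [_ h1uu]].
  destruct (h2u x t u hx) as [h2ux [_ h2uu]].
  destruct (h3u x t u hx) as [h3ux [_ h3uu]].
  assert (m1 := drift_derive A B C theta x hth (h0 x hx)).
  assert (m2 := drift_derive2 A B C theta a b x hth h0 hx).
  assert (E1 : Derive (fun z => phi_x v z t u ux ut) x =
    dx (dx (phi v)) x t u + ux * dx (du (phi v)) x t u
    - ux * (dx (dx (xi v)) x t u + ux * dx (du (xi v)) x t u)
    - ut * (dx (dx (tau v)) x t u + ux * dx (du (tau v)) x t u)).
  { exact (Derive_phi_x _ _ _ _ _ _ x ux ut _ _ _ _ _ _ h3xx h3ux h1xx h1ux h2xx h2ux). }
  assert (E2 : Derive (fun z => phi_x v x t z ux ut) u =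
    du (dx (phi v)) x t u + ux * du (du (phi v)) x t u
    - ux * (du (dx (xi v)) x t u + ux * du (du (xi v)) x t u)
    - ut * (du (dx (tau v)) x t u + ux * du (du (tau v)) x t u)).
  { exact (Derive_phi_x _ _ _ _ _ _ u ux ut _ _ _ _ _ _ h3xu h3uu h1xu h1uu h2xu h2uu). }
  assert (E3 : Derive (fun z => phi_x v x t u z ut) ux =
    du (phi v) x t u - dx (xi v) x t u - 2 * ux * du (xi v) x t u
    - ut * du (tau v) x t u).
  { apply is_derive_unique. unfold phi_x, Dx0. auto_derive; [trivial |]. ring. }
  assert (E4 : Derive (fun z => phi_x v x t u ux z) ut =
    - (dx (tau v) x t u + ux * du (tau v) x t u)).
  { apply is_derive_unique. unfold phi_x, Dx0. auto_derive; [trivial |]. ring. }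
  assert (F1 : Derive (fun z => fpk theta z t u ux ut uxx uxt utt) x =
    (2 * A * x + 4 * B - 2 * mu * (V - mu ^ 2)) * u + (V - mu ^ 2) * ux).
  { apply is_derive_unique. unfold fpk.
    set (m' := Derive (drift theta)) in *.
    set (m := drift theta) in *.
    auto_derive; [repeat split; eexists; eassumption |].
    known_derive. unfold V, mu. ring. }
  assert (M : Derive (drift theta) x = V - mu ^ 2) by (apply is_derive_unique, m1).
  assert (F2 : Derive (fun z => fpk theta x z u ux ut uxx uxt utt) t = 0).
  { exact (Derive_const (fpk theta x t u ux ut uxx uxt utt) t). }
  assert (F3 : Derive (fun z => fpk theta x t z ux ut uxx uxt utt) u = V - mu ^ 2).
  { apply is_derive_unique. unfold fpk. rewrite M. auto_derive; [trivial |]. ring. }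
  assert (F4 : Derive (fun z => fpk theta x t u z ut uxx uxt utt) ux = mu).
  { apply is_derive_unique. unfold fpk. rewrite M. auto_derive; [trivial |].
    unfold mu. ring. }
  assert (F5 : Derive (fun z => fpk theta x t u ux z uxx uxt utt) ut = 1).
  { apply is_derive_unique. unfold fpk. rewrite M. auto_derive; [trivial |]. ring. }
  assert (F6 : Derive (fun z => fpk theta x t u ux ut z uxt utt) uxx = - / 2).
  { apply is_derive_unique. unfold fpk. rewrite M. auto_derive; [trivial |]. ring. }
  assert (F7 : Derive (fun z => fpk theta x t u ux ut uxx z utt) uxt = 0).
  { exact (Derive_const (fpk theta x t u ux ut uxx uxt utt) uxt). }
  assert (F8 : Derive (fun z => fpk theta x t u ux ut uxx uxt z) utt = 0).
  { exact (Derive_const (fpk theta x t u ux ut uxx uxt utt) utt). }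
  unfold pr2. rewrite F1, F2, F3, F4, F5, F6, F7, F8.
  unfold phi_xx, Dx1. rewrite E1, E2, E3, E4.
  unfold phi_x, phi_t, Dx0, Dt0, p. fold mu. ring.
Qed.

Lemma vanishing_partials (a b : Rbar) (f : R -> R -> R -> R) :
  (forall x t u, between a b x -> f x t u = 0) ->
  forall x t u, between a b x ->
    dx f x t u = 0 /\ dt f x t u = 0 /\ du f x t u = 0.
Proof.
  intros hf x t u hx. split; [| split].
  - unfold dx. rewrite (Derive_ext_loc _ (fun _ => 0)); [apply Derive_const |].
    apply (filter_imp (between a b)); [| apply locally_between, hx]. auto.
  - unfold dt. rewrite (Derive_ext _ (fun _ => 0)); [apply Derive_const |]. auto.
  - unfold du. rewrite (Derive_ext _ (fun _ => 0)); [apply Derive_const |]. auto.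
Qed.

(** The mixed derivative [uxt] enters the prolonged equation only through
    [- 2 uxt (tau_x + ux tau_u)] in the coefficient of second order in [x]. *)
Lemma symmetry_tau (A B C : R) (theta : R -> R) (a b : Rbar) (v : vfield) :
  theta_equation A B C theta -> (forall y, between a b y -> theta y <> 0) ->
  infinitesimal_symmetry theta (between a b) v ->
  forall x t u, between a b x -> dx (tau v) x t u = 0 /\ du (tau v) x t u = 0.
Proof.
  intros hth h0 [hv hs] x t u hx.
  set (ut := fun ux => - (Derive (drift theta) x * u + drift theta x * ux)).
  assert (H : forall ux uxt, pr2 v (fpk theta) x t u ux (ut ux) 0 uxt 0 = 0).
  { intros ux uxt. apply hs; [exact hx |]. unfold fpk, ut. ring. }
  assert (H00 := H 0 0). assert (H01 := H 0 1).
  assert (H10 := H 1 0). assert (H11 := H 1 1).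
  rewrite (pr2_fpk A B C _ a b) in H00, H01, H10, H11; auto.
  split; lra.
Qed.

(** With [tau] a function of [t] alone, these are the coefficients of [ux * uxx]
    and of [uxx]. *)
Lemma symmetry_xi (A B C : R) (theta : R -> R) (a b : Rbar) (v : vfield) :
  theta_equation A B C theta -> (forall y, between a b y -> theta y <> 0) ->
  infinitesimal_symmetry theta (between a b) v ->
  forall x t u, between a b x ->
    du (xi v) x t u = 0 /\ dt (tau v) x t u = 2 * dx (xi v) x t u.
Proof.
  intros hth h0 hv.
  assert (T := symmetry_tau A B C theta a b v hth h0 hv).
  destruct hv as [hv hs]. intros x t u hx.
  assert (Tx := vanishing_partials a b (dx (tau v)) (fun x t u h => proj1 (T x t u h))).
  assert (Tu := vanishing_partials a b (du (tau v)) (fun x t u h => proj2 (T x t u h))).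
  destruct (T x t u hx) as [t1 t2].
  destruct (Tx x t u hx) as [t3 [_ t4]]. destruct (Tu x t u hx) as [t5 [_ t6]].
  set (ut := fun ux uxx => / 2 * uxx
    - (Derive (drift theta) x * u + drift theta x * ux)).
  assert (H : forall ux uxx, pr2 v (fpk theta) x t u ux (ut ux uxx) uxx 0 0 = 0).
  { intros ux uxx. apply hs; [exact hx |]. unfold fpk, ut. ring. }
  assert (H00 := H 0 0). assert (H01 := H 0 1).
  assert (H10 := H 1 0). assert (H11 := H 1 1).
  rewrite (pr2_fpk A B C _ a b) in H00, H01, H10, H11; auto.
  rewrite t1, t2, t3, t4, t5, t6 in *. unfold ut in *.
  split; lra.
Qed.

(** The coefficients of [ux ^ 2], [ux] and [1]. The second derivatives of [xi] have
    dropped out, since [xi_x = tau' / 2] is a function of [t] alone. *)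
Lemma symmetry_phi (A B C : R) (theta : R -> R) (a b : Rbar) (v : vfield) :
  theta_equation A B C theta -> (forall y, between a b y -> theta y <> 0) ->
  infinitesimal_symmetry theta (between a b) v ->
  forall x t u, between a b x ->
  let mu := drift theta x in
  let M := potential A B C x - mu ^ 2 in
  let p := fun f : R -> R -> R -> R => f x t u in
  du (du (phi v)) x t u = 0 /\
  p (xi v) * M + mu * p (dx (xi v)) - p (dt (xi v))
    - / 2 * (p (dx (du (phi v))) + p (du (dx (phi v)))) = 0 /\
  p (xi v) * (2 * A * x + 4 * B - 2 * mu * M) * u + p (phi v) * M
    + mu * p (dx (phi v)) + p (dt (phi v))
    - M * u * (p (du (phi v)) - 2 * p (dx (xi v)))
    - / 2 * p (dx (dx (phi v))) = 0.
Proof.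
  intros hth h0 hv.
  assert (T := symmetry_tau A B C theta a b v hth h0 hv).
  assert (X := symmetry_xi A B C theta a b v hth h0 hv).
  destruct hv as [hv hs]. intros x t u hx mu M p.
  assert (Tx := vanishing_partials a b (dx (tau v)) (fun x t u h => proj1 (T x t u h))).
  assert (Tu := vanishing_partials a b (du (tau v)) (fun x t u h => proj2 (T x t u h))).
  assert (Xu := vanishing_partials a b (du (xi v)) (fun x t u h => proj1 (X x t u h))).
  assert (Tt : forall x t u, between a b x ->
    dt (tau v) x t u = dt (tau v) x t 0 /\
    locally x (fun y => dt (tau v) y t u = dt (tau v) x t u)).
  { clear x t u hx mu M p. intros x t u hx.
    destruct (hv 1%nat) as [_ [ht _]].
    apply class_C_derive in ht. destruct ht as [ht _].
    split.
    - apply Derive_ext. intros s.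
      transitivity (tau v x s 0); [| reflexivity].
      apply (constant_on_between m_infty p_infty (fun w => tau v x s w)); try exact I.
      + intros w _. rewrite <- (proj2 (T x s w hx)). apply (ht x s w hx).
      + split; exact I.
      + split; exact I.
    - apply (filter_imp (between a b)); [| apply locally_between, hx].
      intros y hy. apply Derive_ext. intros s.
      apply (constant_on_between a b (fun w => tau v w s u)); auto.
      intros w hw. rewrite <- (proj1 (T w s u hw)). apply (ht w s u hw). }
  assert (Xuu : du (dx (xi v)) x t u = 0).
  { unfold du at 1. rewrite (Derive_ext _ (fun _ => dx (xi v) x t u));
      [apply Derive_const |].
    intros w. destruct (X x t u hx) as [_ e1]. destruct (X x t w hx) as [_ e2].
    destruct (Tt x t u hx) as [e3 _]. destruct (Tt x t w hx) as [e4 _]. lra. }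
  assert (Xxx : dx (dx (xi v)) x t u = 0).
  { unfold dx at 1. rewrite (Derive_ext_loc _ (fun _ => dx (xi v) x t u));
      [apply Derive_const |].
    destruct (Tt x t u hx) as [_ e].
    generalize (filter_and _ _ e (locally_between a b x hx)).
    apply filter_imp. intros y [e1 hy].
    destruct (X x t u hx) as [_ e2]. destruct (X y t u hy) as [_ e3]. lra. }
  destruct (T x t u hx) as [t1 t2]. destruct (X x t u hx) as [x1 x2].
  destruct (Tx x t u hx) as [t3 [_ t4]]. destruct (Tu x t u hx) as [t5 [_ t6]].
  destruct (Xu x t u hx) as [x3 [_ x4]].
  set (ut := fun ux => - (M * u + mu * ux)).
  assert (H : forall ux, pr2 v (fpk theta) x t u ux (ut ux) 0 0 0 = 0).
  { intros ux. apply hs; [exact hx |]. unfold fpk, ut.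
    rewrite (is_derive_unique _ _ _ (drift_derive A B C theta x hth (h0 x hx))).
    fold mu M. ring. }
  assert (H0 := H 0). assert (H1 := H 1). assert (H2 := H (-1)).
  rewrite (pr2_fpk A B C _ a b) in H0, H1, H2; auto.
  rewrite t1, t2, t3, t4, t5, t6, x1, x2, x3, x4, Xuu, Xxx in *.
  unfold ut, p in *. fold mu in H0, H1, H2. fold M in H0, H1, H2.
  split; [| split]; lra.
Qed.

Lemma symmetry_in_u (A B C : R) (theta : R -> R) (a b : Rbar) (v : vfield) :
  theta_equation A B C theta -> (forall y, between a b y -> theta y <> 0) ->
  infinitesimal_symmetry theta (between a b) v ->
  forall x t u, between a b x ->
    tau v x t u = tau v x t 0 /\ xi v x t u = xi v x t 0 /\
    phi v x t u = du (phi v) x t 0 * u + phi v x t 0.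
Proof.
  intros hth h0 hv x t u hx.
  assert (T := symmetry_tau A B C theta a b v hth h0 hv).
  assert (X := symmetry_xi A B C theta a b v hth h0 hv).
  assert (P := symmetry_phi A B C theta a b v hth h0 hv).
  destruct hv as [hv _]. destruct (hv 2%nat) as [d1 [d2 d3]].
  apply class_C_derive in d1, d2, d3.
  destruct d1 as [d1 _], d2 as [d2 _], d3 as [d3 [_ [_ d4]]].
  apply class_C_derive in d4. destruct d4 as [d4 _].
  split; [| split].
  - apply (constant_on_line (fun w => tau v x t w)). intros w.
    rewrite <- (proj2 (T x t w hx)). apply (d2 x t w hx).
  - apply (constant_on_line (fun w => xi v x t w)). intros w.
    rewrite <- (proj1 (X x t w hx)). apply (d1 x t w hx).
  - assert (E : forall w, du (phi v) x t w = du (phi v) x t 0).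
    { apply (constant_on_line (fun w => du (phi v) x t w)). intros w.
      rewrite <- (proj1 (P x t w hx)). apply (d4 x t w hx). }
    assert (F : phi v x t u - du (phi v) x t 0 * u
                = phi v x t 0 - du (phi v) x t 0 * 0).
    { apply (constant_on_line (fun w => phi v x t w - du (phi v) x t 0 * w)).
      intros w. destruct (d3 x t w hx) as [_ [_ e]]. rewrite E in e.
      set (f := fun w => phi v x t w) in *. change (phi v x t) with f.
      derive. ring. }
    lra.
Qed.

(** As [phi] is affine in [u], both mixed derivatives of [phi] are the [x]-derivative
    of its slope, and the last determining equation splits into one for the slope and
    one for [phi] at [u = 0]; the latter says that [phi] at [u = 0] solves the
    equation and is left aside. *)
Lemma symmetry_equations (A B C : R) (theta : R -> R) (a b : Rbar) (v : vfield) :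
  theta_equation A B C theta -> (forall y, between a b y -> theta y <> 0) ->
  infinitesimal_symmetry theta (between a b) v ->
  forall x t, between a b x ->
  let mu := drift theta x in
  let M := potential A B C x - mu ^ 2 in
  let p := fun f : R -> R -> R -> R => f x t 0 in
  p (dx (du (phi v))) = p (xi v) * M + mu * p (dx (xi v)) - p (dt (xi v)) /\
  p (xi v) * (2 * A * x + 4 * B - 2 * mu * M) + mu * p (dx (du (phi v)))
    + p (dt (du (phi v))) + 2 * M * p (dx (xi v))
    - / 2 * p (dx (dx (du (phi v)))) = 0.
Proof.
  intros hth h0 hv x t hx mu M p.
  assert (U := symmetry_in_u A B C theta a b v hth h0 hv).
  assert (P := symmetry_phi A B C theta a b v hth h0 hv).
  destruct hv as [hv _]. destruct (hv 3%nat) as [_ [_ d]].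
  apply class_C_derive in d. destruct d as [d [d1 [_ d2]]].
  apply class_C_derive in d1, d2. destruct d1 as [d1 _], d2 as [d2 [d3 _]].
  apply class_C_derive in d3. destruct d3 as [d3 _].
  assert (hloc : forall y, between a b y -> locally y (between a b))
    by (intros; apply locally_between; assumption).
  assert (Fx : forall y u, between a b y ->
    dx (phi v) y t u = dx (du (phi v)) y t 0 * u + dx (phi v) y t 0).
  { intros y u hy. apply is_derive_unique.
    apply (is_derive_ext_loc (fun z => du (phi v) z t 0 * u + phi v z t 0)).
    - apply (filter_imp (between a b)); [| auto]. intros z hz. symmetry. apply U, hz.
    - destruct (d y t 0 hy) as [e1 _]. destruct (d2 y t 0 hy) as [e2 _].
      set (f := du (phi v)) in *. set (g := phi v) in *.
      auto_derive; [repeat split; eexists; eassumption |]. known_derive. ring. }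
  assert (Ft : forall u,
    dt (phi v) x t u = dt (du (phi v)) x t 0 * u + dt (phi v) x t 0).
  { intros u. apply is_derive_unique.
    apply (is_derive_ext (fun s => du (phi v) x s 0 * u + phi v x s 0)).
    - intros s. symmetry. apply U, hx.
    - destruct (d x t 0 hx) as [_ [e1 _]]. destruct (d2 x t 0 hx) as [_ [e2 _]].
      set (f := du (phi v)) in *. set (g := phi v) in *.
      auto_derive; [repeat split; eexists; eassumption |]. known_derive. ring. }
  assert (Fu : forall u, du (phi v) x t u = du (phi v) x t 0).
  { intros u. apply is_derive_unique.
    apply (is_derive_ext (fun w => du (phi v) x t 0 * w + phi v x t 0)).
    - intros s. symmetry. apply U, hx.
    - auto_derive; [trivial |]. ring. }
  assert (Fxu : du (dx (phi v)) x t 0 = dx (du (phi v)) x t 0).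
  { apply is_derive_unique.
    apply (is_derive_ext (fun w => dx (du (phi v)) x t 0 * w + dx (phi v) x t 0)).
    - intros w. symmetry. apply Fx, hx.
    - auto_derive; [trivial |]. ring. }
  assert (Fxx : dx (dx (phi v)) x t 1
                = dx (dx (du (phi v))) x t 0 + dx (dx (phi v)) x t 0).
  { apply is_derive_unique.
    apply (is_derive_ext_loc
             (fun z => dx (du (phi v)) z t 0 * 1 + dx (phi v) z t 0)).
    - apply (filter_imp (between a b)); [| auto]. intros z hz. symmetry. apply Fx, hz.
    - destruct (d1 x t 0 hx) as [e1 _]. destruct (d3 x t 0 hx) as [e2 _].
      set (f := dx (du (phi v))) in *. set (g := dx (phi v)) in *.
      auto_derive; [repeat split; eexists; eassumption |]. known_derive. ring. }
  assert (Xx : dx (xi v) x t 1 = dx (xi v) x t 0).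
  { apply Derive_ext_loc. apply (filter_imp (between a b)); [| auto].
    intros y hy. apply U, hy. }
  destruct (P x t 0 hx) as [_ [E0 E1]]. destruct (P x t 1 hx) as [_ [_ E2]].
  destruct (U x t 1 hx) as [_ [U2 U3]].
  rewrite Fxu in E0. rewrite (Fx x 1 hx), (Ft 1), (Fu 1), Fxx, Xx, U2, U3 in E2.
  unfold p. fold mu in E0, E1, E2. fold M in E0, E1, E2.
  split; lra.
Qed.

Lemma quadratic_vanishing (p q r h x : R) :
  locally x (fun y => p * (y + h) ^ 2 + q * (y + h) + r = 0) ->
  p = 0 /\ q = 0 /\ r = 0.
Proof.
  intros [eps H]. assert (he := cond_pos eps).
  assert (H' : forall y, Rabs (y - x) < eps ->
    p * (y + h) ^ 2 + q * (y + h) + r = 0).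
  { intros y hy. apply H. exact hy. }
  assert (H0 := H' x). assert (H1 := H' (x + eps / 2)). assert (H2 := H' (x - eps / 2)).
  specialize (H0 ltac:(unfold Rabs; destruct (Rcase_abs _); lra)).
  specialize (H1 ltac:(unfold Rabs; destruct (Rcase_abs _); lra)).
  specialize (H2 ltac:(unfold Rabs; destruct (Rcase_abs _); lra)).
  set (e := eps / 2) in *. assert (hee : 0 < e) by (unfold e; lra).
  assert (hp : p = 0).
  { apply (Rmult_eq_reg_r (2 * e ^ 2)); [| nra]. lra. }
  subst p.
  assert (hq : q = 0).
  { apply (Rmult_eq_reg_r (2 * e)); [| lra]. lra. }
  subst q. lra.
Qed.

(** [phi = (drift * xi + psi) u + phi0]: the summand [drift * xi] is what the
    factor [theta] of the substitution [u = theta w] contributes, and [psi] is the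
    multiplier of the same field on the oscillator
    [w_t = w_xx / 2 - (A x ^ 2 + 4 B x + 2 C) w / 2]. *)
Definition oscillator_multiplier (A B C c1 c2 c3 d e c x t : R) : R :=
  let w := exp (sqrt A * t) in
  let y := x + 2 * B / A in
  - A * (c2 * w ^ 2 + c3 / w ^ 2) * y ^ 2 - sqrt A * (d * w - e / w) * y
  + (2 * B ^ 2 / A - C) * (c1 + c2 * w ^ 2 + c3 / w ^ 2)
  - sqrt A / 2 * (c2 * w ^ 2 - c3 / w ^ 2) + c.

Definition generator (A B C : R) (theta : R -> R) (I : R -> Prop) (v : vfield)
  (c1 c2 c3 d e c : R) (phi0 : R -> R -> R) : Prop :=
  forall x t u, I x ->
    let w := exp (sqrt A * t) in
    tau v x t u = c1 + c2 * w ^ 2 + c3 / w ^ 2 /\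
    xi v x t u = sqrt A * (c2 * w ^ 2 - c3 / w ^ 2) * (x + 2 * B / A)
                 + d * w + e / w /\
    phi v x t u = (drift theta x * xi v x t u
                   + oscillator_multiplier A B C c1 c2 c3 d e c x t) * u
                  + phi0 x t.

(** The determining equations make [xi] equal to [tau' y / 2 + rho(t)] and [psi]
    equal to [- tau'' y ^ 2 / 4 - rho' y + sigma(t)], where [y = x + 2 B / A];
    comparing the powers of [y] in the last of them leaves [g'' = 4 A g] for
    [g = tau'], [rho'' = A rho] and [sigma' = (2 B ^ 2 / A - C) g - g' / 4]. *)
Lemma symmetry_generator (A B C : R) (theta : R -> R) (a b : Rbar) (v : vfield)
  (x0 : R) :
  0 < A -> theta_equation A B C theta ->
  (forall y, between a b y -> theta y <> 0) -> between a b x0 ->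
  infinitesimal_symmetry theta (between a b) v ->
  exists c1 c2 c3 d e c phi0,
    generator A B C theta (between a b) v c1 c2 c3 d e c phi0.
Proof.
  intros hA hth h0 hx0 hv.
  assert (U := symmetry_in_u A B C theta a b v hth h0 hv).
  assert (T := symmetry_tau A B C theta a b v hth h0 hv).
  assert (X := symmetry_xi A B C theta a b v hth h0 hv).
  assert (E := symmetry_equations A B C theta a b v hth h0 hv).
  destruct hv as [hv _]. destruct (hv 3%nat) as [s1 [s2 s3]]. clear hv.
  apply class_C_derive in s1, s2, s3.
  destruct s1 as [dxi [_ [s1 _]]], s2 as [dtau [_ [s2 _]]], s3 as [_ [_ [_ s3]]].
  apply class_C_derive in s1, s2, s3.
  destruct s1 as [dxi2 _], s2 as [dtau2 [_ [s2 _]]], s3 as [dphi _].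
  apply class_C_derive in s2. destruct s2 as [dtau3 _].
  set (h := 2 * B / A) in *. set (k := 2 * B ^ 2 / A - C) in *.
  set (y0 := x0 + h).
  set (g0 := fun t => tau v x0 t 0). set (g := fun t => dt (tau v) x0 t 0).
  set (g2 := fun t => dt (dt (tau v)) x0 t 0).
  set (g3 := fun t => dt (dt (dt (tau v))) x0 t 0).
  set (r := fun t => xi v x0 t 0). set (r1 := fun t => dt (xi v) x0 t 0).
  set (r2 := fun t => dt (dt (xi v)) x0 t 0).
  set (f0 := fun t => du (phi v) x0 t 0). set (f1 := fun t => dt (du (phi v)) x0 t 0).
  assert (G0 : forall t, is_derive g0 t (g t)) by (intros t; apply (dtau x0 t 0 hx0)).
  assert (G1 : forall t, is_derive g t (g2 t)) by (intros t; apply (dtau2 x0 t 0 hx0)).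
  assert (G2 : forall t, is_derive g2 t (g3 t)) by (intros t; apply (dtau3 x0 t 0 hx0)).
  assert (R0 : forall t, is_derive r t (r1 t)) by (intros t; apply (dxi x0 t 0 hx0)).
  assert (R1 : forall t, is_derive r1 t (r2 t)) by (intros t; apply (dxi2 x0 t 0 hx0)).
  assert (F0 : forall t, is_derive f0 t (f1 t)) by (intros t; apply (dphi x0 t 0 hx0)).
  set (rho := fun t => r t - g t / 2 * y0).
  set (rho1 := fun t => r1 t - g2 t / 2 * y0).
  set (rho2 := fun t => r2 t - g3 t / 2 * y0).
  assert (Rh0 : forall t, is_derive rho t (rho1 t)).
  { intros t. specialize (R0 t). specialize (G1 t). unfold rho, rho1.
    derive. lra. }
  assert (Rh1 : forall t, is_derive rho1 t (rho2 t)).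
  { intros t. specialize (R1 t). specialize (G2 t). unfold rho1, rho2.
    derive. lra. }
  assert (Tau : forall x t, between a b x -> tau v x t 0 = g0 t).
  { intros x t hx. apply (constant_on_between a b (fun y => tau v y t 0)); auto.
    intros y hy. destruct (dtau y t 0 hy) as [e1 _].
    rewrite (proj1 (T y t 0 hy)) in e1. exact e1. }
  assert (Taut : forall x t, between a b x -> dt (tau v) x t 0 = g t).
  { intros x t hx. apply Derive_ext. intros s. rewrite (Tau x s hx). reflexivity. }
  assert (Xix : forall x t, between a b x -> dx (xi v) x t 0 = g t / 2).
  { intros x t hx. rewrite <- (Taut x t hx), (proj2 (X x t 0 hx)). lra. }
  assert (Xi : forall x t, between a b x -> xi v x t 0 = g t / 2 * (x + h) + rho t).
  { intros x t hx.
    assert (H := constant_on_between a b (fun y => xi v y t 0 - g t / 2 * y)).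
    specialize (H ltac:(intros y hy; destruct (dxi y t 0 hy) as [e1 _];
      rewrite (Xix y t hy) in e1; set (f := xi v) in *; derive; ring) x x0 hx hx0).
    unfold rho, r, y0. cbv beta in H. lra. }
  assert (Xit : forall x t, between a b x ->
    dt (xi v) x t 0 = g2 t / 2 * (x + h) + rho1 t).
  { intros x t hx. apply is_derive_unique.
    apply (is_derive_ext (fun s => g s / 2 * (x + h) + rho s)).
    - intros s. symmetry. apply Xi, hx.
    - specialize (G1 t). specialize (Rh0 t). derive. lra. }
  set (M := fun x => potential A B C x - drift theta x ^ 2).
  assert (mu1 : forall x, between a b x -> is_derive (drift theta) x (M x)).
  { intros x hx. apply drift_derive; auto. }
  assert (M1 : forall x, between a b x ->
    is_derive M x (2 * A * x + 4 * B - 2 * drift theta x * M x)).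
  { intros x hx. assert (e1 := mu1 x hx). unfold M in *. unfold potential in *.
    set (m := drift theta) in *. derive. unfold m. ring. }
  set (sigma := fun t => f0 t - r t * drift theta x0
    + (g2 t / 4 * y0 ^ 2 + rho1 t * y0)).
  set (sigma1 := fun t => f1 t - r1 t * drift theta x0
    + (g3 t / 4 * y0 ^ 2 + rho2 t * y0)).
  assert (Sig : forall t, is_derive sigma t (sigma1 t)).
  { intros t. specialize (F0 t). specialize (R0 t). specialize (G2 t).
    specialize (Rh1 t). unfold sigma, sigma1. derive. lra. }
  assert (P : forall x t, between a b x ->
    du (phi v) x t 0 = drift theta x * xi v x t 0
      - (g2 t / 4 * (x + h) ^ 2 + rho1 t * (x + h)) + sigma t).
  { intros x t hx.
    assert (H := constant_on_between a b (fun y => du (phi v) y t 0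
      - drift theta y * xi v y t 0 + (g2 t / 4 * (y + h) ^ 2 + rho1 t * (y + h)))).
    specialize (H ltac:(intros y hy; destruct (dphi y t 0 hy) as [e1 _];
      destruct (dxi y t 0 hy) as [e2 _]; assert (e3 := mu1 y hy);
      rewrite (proj1 (E y t hy)) in e1; fold (M y) in e1;
      rewrite (Xix y t hy) in e2; rewrite (Xix y t hy), (Xit y t hy) in e1;
      set (f := xi v) in *; set (f' := du (phi v)) in *;
      set (m := drift theta) in *; derive; lra) x x0 hx hx0).
    cbv beta in H. unfold sigma, f0, r, y0. lra. }
  assert (Pt : forall x t, between a b x ->
    dt (du (phi v)) x t 0 = drift theta x * dt (xi v) x t 0
      - (g3 t / 4 * (x + h) ^ 2 + rho2 t * (x + h)) + sigma1 t).
  { intros x t hx. apply is_derive_unique.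
    apply (is_derive_ext (fun s => drift theta x * xi v x s 0
      - (g2 s / 4 * (x + h) ^ 2 + rho1 s * (x + h)) + sigma s)).
    - intros s. symmetry. apply P, hx.
    - specialize (G2 t). specialize (Rh1 t). specialize (Sig t).
      destruct (dxi x t 0 hx) as [_ [e1 _]]. set (f := xi v) in *. derive. lra. }
  assert (Pxx : forall x t, between a b x ->
    dx (dx (du (phi v))) x t 0 =
      2 * (g t / 2) * M x
      + xi v x t 0 * (2 * A * x + 4 * B - 2 * drift theta x * M x) - g2 t / 2).
  { intros x t hx. apply is_derive_unique.
    apply (is_derive_ext_loc (fun y => xi v y t 0 * M y + drift theta y * (g t / 2)
      - (g2 t / 2 * (y + h) + rho1 t))).
    - apply (filter_imp (between a b)); [| apply locally_between, hx].
      intros y hy. rewrite (proj1 (E y t hy)), (Xix y t hy), (Xit y t hy).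
      reflexivity.
    - destruct (dxi x t 0 hx) as [e1 _]. rewrite (Xix x t hx) in e1.
      assert (e2 := mu1 x hx). assert (e3 := M1 x hx).
      set (f := xi v) in *. set (m := drift theta) in *. clearbody M.
      derive. ring. }
  assert (Q : forall t, A * g t - g3 t / 4 = 0 /\ A * rho t - rho2 t = 0 /\
    sigma1 t - k * g t + g2 t / 4 = 0).
  { intros t.
    apply (quadratic_vanishing _ _ _ h x0).
    apply (filter_imp (between a b)); [| apply locally_between, hx0].
    intros x hx. destruct (E x t hx) as [e1 e2].
    fold (M x) in e1, e2.
    rewrite e1, (Pt x t hx), (Pxx x t hx), (Xix x t hx), (Xit x t hx),
      (Xi x t hx) in e2.
    assert (V : potential A B C x = A * (x + h) ^ 2 - 2 * k).
    { unfold potential, h, k. field. lra. }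
    assert (V' : 2 * A * x + 4 * B = 2 * A * (x + h)).
    { unfold h. field. lra. }
    unfold M in e2. rewrite V, V' in e2. lra. }
  set (q := sqrt A) in *.
  assert (hq : 0 < q) by (apply sqrt_lt_R0, hA).
  assert (hqq : q ^ 2 = A).
  { unfold q. rewrite <- Rsqr_pow2. apply Rsqr_sqrt. lra. }
  destruct (hyperbolic_ode (2 * q) g g2) as [p1 [p2 Hg]]; [lra | exact G1 | |].
  { intros t. replace ((2 * q) ^ 2 * g t) with (g3 t); [apply G2 |].
    destruct (Q t) as [e _]. replace ((2 * q) ^ 2) with (4 * A) by (rewrite <- hqq; ring).
    lra. }
  destruct (hyperbolic_ode q rho rho1) as [d [e Hr]]; [exact hq | exact Rh0 | |].
  { intros t. rewrite hqq. replace (A * rho t) with (rho2 t); [apply Rh1 |].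
    destruct (Q t) as [_ [e _]]. lra. }
  assert (W : forall t, exp (2 * q * t) = exp (q * t) ^ 2 /\
    exp (- (2 * q) * t) = / exp (q * t) ^ 2 /\ exp (- q * t) = / exp (q * t)).
  { intros t. split; [| split].
    - simpl. rewrite Rmult_1_r, <- exp_plus. f_equal. ring.
    - simpl. rewrite Rmult_1_r, <- exp_plus, <- exp_Ropp. f_equal. ring.
    - rewrite <- exp_Ropp. f_equal. ring. }
  set (c2 := p1 / (2 * q)). set (c3 := - p2 / (2 * q)).
  assert (Hg0 : forall t, g0 t = (g0 0 - c2 - c3)
    + c2 * exp (q * t) ^ 2 + c3 / exp (q * t) ^ 2).
  { intros t.
    assert (H := constant_on_line (fun t => g0 t - c2 * exp (2 * q * t)
      - c3 * exp (- (2 * q) * t))).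
    specialize (H ltac:(intros s; specialize (G0 s); rewrite (proj1 (Hg s)) in G0;
      derive; unfold c2, c3; field; lra) t).
    cbv beta in H. destruct (W t) as [w1 [w2 _]]. rewrite w1, w2 in H.
    rewrite !Rmult_0_r, exp_0 in H. unfold Rdiv. lra. }
  assert (Hs : forall t, sigma t = k * g0 t - g t / 4 + (sigma 0 - k * g0 0 + g 0 / 4)).
  { intros t.
    assert (H := constant_on_line (fun t => sigma t - k * g0 t + g t / 4)).
    specialize (H ltac:(intros s; specialize (Sig s); specialize (G0 s);
      specialize (G1 s); destruct (Q s) as [_ [_ e1]]; derive; lra) t).
    cbv beta in H. lra. }
  exists (g0 0 - c2 - c3), c2, c3, d, e, (sigma 0 - k * g0 0 + g 0 / 4),
    (fun x t => phi v x t 0).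
  intros x t u hx w. destruct (U x t u hx) as [u1 [u2 u3]].
  destruct (W t) as [w1 [w2 w3]]. destruct (Hg t) as [g1' g2'].
  destruct (Hr t) as [r1' r2'].
  rewrite w1, w2 in g1', g2'. rewrite w3 in r1', r2'. fold q in w.
  fold w in g1', g2', r1', r2'.
  assert (hw : 0 < w) by apply exp_pos.
  split; [| split].
  - rewrite u1, (Tau x t hx). apply Hg0.
  - rewrite u2, (Xi x t hx), g1', r1'. fold q. unfold c2, c3. fold h. field.
    repeat split; apply Rgt_not_eq; assumption.
  - rewrite u2, u3, (P x t hx). unfold oscillator_multiplier.
    f_equal. f_equal. unfold Rminus at 1. rewrite Rplus_assoc. f_equal.
    rewrite Hs, (Hg0 t), g1', g2', r2'. fold q. fold w. fold h. fold k.
    rewrite <- hqq. unfold c2, c3. field.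
    repeat split; apply Rgt_not_eq; assumption.
Qed.

(** * Exponentials of the infinitesimal symmetries *)

(** In the coordinates [p = l w ^ 2], [q = l], [r = l w y] with
    [w = exp (sqrt A t)] and [y = x + 2 B / A], the flows become linear: [p], [q]
    transform by a matrix of determinant one and [r] is shifted by a linear
    combination of them.  The remaining field is the logarithm of a constant
    multiplier. *)
Record oscillator_map := OscMap {
  e11 : R; e12 : R; e21 : R; e22 : R;
  shift_p : R; shift_q : R;
  log_scale : R }.

Definition unimodular (g : oscillator_map) : Prop :=
  e11 g * e22 g - e12 g * e21 g = 1.

(** The projective factor of the Moebius map [w ^ 2 |-> p / q]. *)
Definition projective_factor (A : R) (g : oscillator_map) (t0 : R) : R :=
  e21 g * exp (sqrt A * t0) ^ 2 + e22 g.

Definition carries (A B : R) (g : oscillator_map) (x0 t0 x t : R) : Prop :=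
  let w0 := exp (sqrt A * t0) in
  let w := exp (sqrt A * t) in
  let l := projective_factor A g t0 in
  0 < l /\
  e11 g * w0 ^ 2 + e12 g = l * w ^ 2 /\
  l * w * (x + 2 * B / A)
  = w0 * (x0 + 2 * B / A) + shift_p g * w0 ^ 2 + shift_q g.

(** Logarithm of the multiplier on the oscillator, a generating function of the
    affine map of [(p, q, r)]: no trace of the path from the initial to the final
    point remains in it. The terms [ln l / 2 + sqrt A (t - t0) / 2] are a quarter of
    the logarithm of [p q / (p0 q0)]. *)
Definition log_multiplier (A B C : R) (g : oscillator_map) (x0 t0 x t : R) : R :=
  let w0 := exp (sqrt A * t0) in
  let w := exp (sqrt A * t) in
  let y0 := x0 + 2 * B / A in
  let y := x + 2 * B / A in
  let l := projective_factor A g t0 in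
  (2 * B ^ 2 / A - C + sqrt A / 2) * (t - t0) + ln l / 2
  - sqrt A / 2 * (y ^ 2 - y0 ^ 2)
  - sqrt A * l * e12 g * y ^ 2 / w0 ^ 2
  + sqrt A * (l * w * y + w0 * y0) * shift_q g / w0 ^ 2
  + log_scale g.

Definition full_multiplier (A B C : R) (theta : R -> R) (g : oscillator_map)
  (x0 t0 x t : R) : R :=
  theta x / theta x0 * exp (log_multiplier A B C g x0 t0 x t).

Definition identity_map : oscillator_map := OscMap 1 0 0 1 0 0 0.

Lemma carries_identity (A B x t : R) : carries A B identity_map x t x t.
Proof. unfold carries, projective_factor; simpl. split; [lra |]. split; ring. Qed.

(** The base point is determined: the second component of the linear map gives
    [l], the first one [t], and the third one [x]. *)
Lemma carries_unique (A B : R) (g : oscillator_map) (x0 t0 x t x' t' : R) :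
  0 < A -> carries A B g x0 t0 x t -> carries A B g x0 t0 x' t' -> x = x' /\ t = t'.
Proof.
  unfold carries. set (l := projective_factor A g t0).
  intros hA [hl [h1 h2]] [_ [h3 h4]].
  assert (hq : 0 < sqrt A) by (apply sqrt_lt_R0, hA).
  assert (w1 := exp_pos (sqrt A * t)). assert (w2 := exp_pos (sqrt A * t')).
  assert (e : exp (sqrt A * t) = exp (sqrt A * t')).
  { assert (e : exp (sqrt A * t) ^ 2 = exp (sqrt A * t') ^ 2).
    { apply (Rmult_eq_reg_l l); lra. }
    set (w := exp (sqrt A * t)) in *. set (w' := exp (sqrt A * t')) in *.
    assert ((w - w') * (w + w') = 0) by lra.
    apply Rmult_integral in H. lra. }
  rewrite e in h2. split.
  - apply (Rplus_eq_reg_r (2 * B / A)).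
    apply (Rmult_eq_reg_l (l * exp (sqrt A * t'))); [lra |].
    apply Rgt_not_eq, Rmult_lt_0_compat; assumption.
  - apply exp_inv in e. apply (Rmult_eq_reg_l (sqrt A)); lra.
Qed.

(** [g' = N g] for the matrix [N] by which the field with the given constants acts
    on [(p, q, r)]; the derivative of [log_scale] is the Heisenberg cocycle. *)
Definition is_flow (A c1 c2 c3 d e c : R) (g : R -> oscillator_map) : Prop :=
  let q := sqrt A in
  forall s,
    is_derive (fun s => e11 (g s)) s (q * (c1 * e11 (g s) + 2 * c3 * e21 (g s))) /\
    is_derive (fun s => e12 (g s)) s (q * (c1 * e12 (g s) + 2 * c3 * e22 (g s))) /\
    is_derive (fun s => e21 (g s)) s (- q * (c1 * e21 (g s) + 2 * c2 * e11 (g s))) /\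
    is_derive (fun s => e22 (g s)) s (- q * (c1 * e22 (g s) + 2 * c2 * e12 (g s))) /\
    is_derive (fun s => shift_p (g s)) s (d * e11 (g s) + e * e21 (g s)) /\
    is_derive (fun s => shift_q (g s)) s (d * e12 (g s) + e * e22 (g s)) /\
    is_derive (fun s => log_scale (g s)) s
      (c + q * (shift_p (g s) * (d * e12 (g s) + e * e22 (g s))
                - shift_q (g s) * (d * e11 (g s) + e * e21 (g s)))).

Lemma flow_exists (A c1 c2 c3 d e c : R) (g0 : oscillator_map) :
  exists g : R -> oscillator_map, g 0 = g0 /\ is_flow A c1 c2 c3 d e c g.
Proof.
  destruct g0 as [a11 a12 a21 a22 ap aq ac]. set (q := sqrt A).
  destruct (planar_linear_ode (q * c1) (q * (2 * c3)) (- q * (2 * c2)) a11 a21)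
    as [f11 [f21 [i11 [i21 [h11 h21]]]]].
  destruct (planar_linear_ode (q * c1) (q * (2 * c3)) (- q * (2 * c2)) a12 a22)
    as [f12 [f22 [i12 [i22 [h12 h22]]]]].
  assert (hc : forall f f' : R -> R, (forall s, is_derive f s (f' s)) ->
    forall s, continuous f s).
  { intros f f' hf s. exact (is_derive_continuous f s _ (hf s)). }
  assert (hlin : forall (f f' h h' : R -> R) (m n : R),
    (forall s, is_derive f s (f' s)) -> (forall s, is_derive h s (h' s)) ->
    forall s, is_derive (fun s => m * f s + n * h s) s (m * f' s + n * h' s)).
  { intros f f' h h' m n hf hh s. specialize (hf s). specialize (hh s). derive. ring. }
  assert (D1 := hlin _ _ _ _ d e h11 h21). assert (D2 := hlin _ _ _ _ d e h12 h22).
  destruct (antiderivative (fun s => d * f11 s + e * f21 s)) as [Fp [ip hp]].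
  { exact (hc _ _ D1). }
  destruct (antiderivative (fun s => d * f12 s + e * f22 s)) as [Fq [iq hq]].
  { exact (hc _ _ D2). }
  destruct (antiderivative (fun s => c + q * ((ap + Fp s) * (d * f12 s + e * f22 s)
    - (aq + Fq s) * (d * f11 s + e * f21 s)))) as [Fc [ic hcs]].
  { intros s. apply (ex_derive_continuous (K := R_AbsRing) (V := R_NormedModule)).
    specialize (hp s). specialize (hq s). specialize (h11 s). specialize (h21 s).
    specialize (h12 s). specialize (h22 s).
    auto_derive. repeat split; eexists; eassumption. }
  exists (fun s => OscMap (f11 s) (f12 s) (f21 s) (f22 s)
    (ap + Fp s) (aq + Fq s) (ac + Fc s)).
  split.
  - rewrite i11, i12, i21, i22, ip, iq, ic. f_equal; ring.
  - unfold is_flow. fold q. intros s. simpl. clear D1 D2 hc hlin.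
    specialize (hp s). specialize (hq s). specialize (h11 s). specialize (h21 s).
    specialize (h12 s). specialize (h22 s). specialize (hcs s). cbv beta in *.
    split; [| split; [| split; [| split; [| split; [| split]]]]]; derive; ring.
Qed.

Lemma flow_unimodular (A c1 c2 c3 d e c : R) (g : R -> oscillator_map) :
  is_flow A c1 c2 c3 d e c g -> unimodular (g 0) -> forall s, unimodular (g s).
Proof.
  intros hg h0 s. unfold unimodular. rewrite <- h0.
  apply (constant_on_line (fun s => e11 (g s) * e22 (g s) - e12 (g s) * e21 (g s))).
  clear s. intros s. destruct (hg s) as [h11 [h12 [h21 [h22 _]]]].
  set (f11 := fun s => e11 (g s)) in *. set (f12 := fun s => e12 (g s)) in *.
  set (f21 := fun s => e21 (g s)) in *. set (f22 := fun s => e22 (g s)) in *.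
  change (is_derive (fun s => f11 s * f22 s - f12 s * f21 s) s 0).
  derive. unfold f11, f12, f21, f22. ring.
Qed.

(** The integral curves of the base part of a generator. *)
Definition base_curve (A B c1 c2 c3 d e : R) (cx ct : R -> R) : Prop :=
  forall s, 0 <= s <= 1 ->
    let w := exp (sqrt A * ct s) in
    is_derive ct s (c1 + c2 * w ^ 2 + c3 / w ^ 2) /\
    is_derive cx s
      (sqrt A * (c2 * w ^ 2 - c3 / w ^ 2) * (cx s + 2 * B / A) + d * w + e / w).

(** With [P], [Q] the two components of [g s] applied to the start, [P - w ^ 2 Q]
    and [Q] solve scalar linear equations: the former stays zero and the latter
    positive.  The third relation is a first integral. *)
Lemma flow_carries (A B c1 c2 c3 d e c : R) (g : R -> oscillator_map)
  (cx ct : R -> R) (x0 t0 : R) :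
  is_flow A c1 c2 c3 d e c g -> base_curve A B c1 c2 c3 d e cx ct ->
  carries A B (g 0) x0 t0 (cx 0) (ct 0) ->
  forall s, 0 <= s <= 1 -> carries A B (g s) x0 t0 (cx s) (ct s).
Proof.
  intros hg hc [hl0 [hp0 hr0]].
  set (w0 := exp (sqrt A * t0)) in *. set (q := sqrt A) in *.
  set (h := 2 * B / A) in *.
  set (w := fun s => exp (q * ct s)).
  set (P := fun s => e11 (g s) * w0 ^ 2 + e12 (g s)).
  set (Q := fun s => e21 (g s) * w0 ^ 2 + e22 (g s)).
  set (K := fun s => shift_p (g s) * w0 ^ 2 + shift_q (g s)).
  assert (hw : forall s, w s <> 0) by (intros s; apply Rgt_not_eq, exp_pos).
  assert (dw : forall s, 0 <= s <= 1 ->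
    is_derive w s (q * (c1 + c2 * w s ^ 2 + c3 / w s ^ 2) * w s)).
  { intros s hs. destruct (hc s hs) as [h1 _]. unfold w. derive. unfold w, q. ring. }
  assert (dP : forall s, is_derive P s (q * (c1 * P s + 2 * c3 * Q s))).
  { intros s. destruct (hg s) as [h1 [h2 _]].
    set (f1 := fun s => e11 (g s)) in *. set (f2 := fun s => e12 (g s)) in *.
    change P with (fun s => f1 s * w0 ^ 2 + f2 s). derive.
    unfold P, Q, q, f1, f2. ring. }
  assert (dQ : forall s, is_derive Q s (- q * (c1 * Q s + 2 * c2 * P s))).
  { intros s. destruct (hg s) as [_ [_ [h1 [h2 _]]]].
    set (f1 := fun s => e21 (g s)) in *. set (f2 := fun s => e22 (g s)) in *.
    change Q with (fun s => f1 s * w0 ^ 2 + f2 s). derive.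
    unfold P, Q, q, f1, f2. ring. }
  assert (dK : forall s, is_derive K s (d * P s + e * Q s)).
  { intros s. destruct (hg s) as [_ [_ [_ [_ [h1 [h2 _]]]]]].
    set (f1 := fun s => shift_p (g s)) in *. set (f2 := fun s => shift_q (g s)) in *.
    change K with (fun s => f1 s * w0 ^ 2 + f2 s). derive.
    unfold P, Q, f1, f2. ring. }
  assert (cw : forall m n s, 0 <= s <= 1 -> continuous (fun s => m + n * w s ^ 2) s).
  { intros m n s hs. specialize (dw s hs).
    apply (is_derive_continuous (fun s => m + n * w s ^ 2) s
      (n * (2 * w s * (q * (c1 + c2 * w s ^ 2 + c3 / w s ^ 2) * w s)))).
    clearbody w. derive. ring. }
  destruct (scalar_linear_ode (fun s => P s - w s ^ 2 * Q s)
    (fun s => q * c1 + (2 * q * c2) * w s ^ 2)) as [G1 HG1].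
  { intros s hs. apply cw, hs. }
  { intros s hs. specialize (dw s hs). specialize (dP s). specialize (dQ s).
    clearbody w P Q. derive. field. auto. }
  assert (PQ : forall s, 0 <= s <= 1 -> P s = Q s * w s ^ 2).
  { intros s hs. specialize (HG1 s hs). cbv beta in HG1.
    assert (P 0 = Q 0 * w 0 ^ 2) by exact hp0.
    replace (P 0 - w 0 ^ 2 * Q 0) with 0 in HG1 by lra. lra. }
  destruct (scalar_linear_ode Q (fun s => - q * c1 + (- 2 * q * c2) * w s ^ 2))
    as [G2 HG2].
  { intros s hs. apply cw, hs. }
  { intros s hs. specialize (dQ s). rewrite (PQ s hs) in dQ.
    replace ((- q * c1 + - 2 * q * c2 * w s ^ 2) * Q s)
      with (- q * (c1 * Q s + 2 * c2 * (Q s * w s ^ 2))) by ring. exact dQ. }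
  intros s hs. unfold carries, projective_factor. fold q. fold w0. fold (Q s).
  fold (w s). fold (P s). split; [| split].
  - rewrite (HG2 s hs). apply Rmult_lt_0_compat; [exact hl0 | apply exp_pos].
  - apply PQ, hs.
  - assert (H := constant_on_unit (fun s => Q s * w s * (cx s + h) - K s)).
    specialize (H ltac:(clear s hs; intros s hs; destruct (hc s hs) as [_ h1];
      specialize (dw s hs); specialize (dQ s); specialize (dK s);
      rewrite (PQ s hs) in dQ; rewrite (PQ s hs) in dK;
      change (exp (sqrt A * ct s)) with (w s) in h1; fold q in h1; fold h in h1;
      clearbody w P Q K; derive; field; auto) s hs).
    cbv beta in H. assert (H0 : Q 0 * w 0 * (cx 0 + h) = w0 * (x0 + h) + K 0).
    { unfold K. rewrite <- Rplus_assoc. exact hr0. }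
    rewrite Rplus_assoc. fold (K s). fold h. lra.
Qed.

(** The derivative of [ln (p q)] is [- tau'], which gives the summand [- tau' / 4] of
    the [oscillator_multiplier]; the quadratic terms give its summands in [y]. The
    integral of the area form of the two shifts is what [log_scale] collects. *)
Lemma flow_log_multiplier (A B C c1 c2 c3 d e c : R) (g : R -> oscillator_map)
  (cx ct : R -> R) (x0 t0 : R) :
  0 < A ->
  is_flow A c1 c2 c3 d e c g -> base_curve A B c1 c2 c3 d e cx ct ->
  unimodular (g 0) -> carries A B (g 0) x0 t0 (cx 0) (ct 0) ->
  forall s, 0 <= s <= 1 ->
    is_derive (fun s => log_multiplier A B C (g s) x0 t0 (cx s) (ct s)) s
      (oscillator_multiplier A B C c1 c2 c3 d e c (cx s) (ct s)).
Proof.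
  intros hA hg hc hu h0 s hs.
  assert (hq : 0 < sqrt A) by (apply sqrt_lt_R0, hA).
  assert (hqq : sqrt A ^ 2 = A).
  { rewrite <- Rsqr_pow2. apply Rsqr_sqrt. lra. }
  assert (hcar := flow_carries A B c1 c2 c3 d e c g cx ct x0 t0 hg hc h0 s hs).
  assert (hdet := flow_unimodular A c1 c2 c3 d e c g hg hu s).
  destruct (hg s) as [d11 [d12 [d21 [d22 [dp [dq dc]]]]]].
  destruct (hc s hs) as [dct dcx].
  unfold carries in hcar. unfold unimodular in hdet.
  unfold log_multiplier, oscillator_multiplier, projective_factor in *.
  set (f12 := fun s => e12 (g s)) in *.
  set (f21 := fun s => e21 (g s)) in *. set (f22 := fun s => e22 (g s)) in *.
  set (fp := fun s => shift_p (g s)) in *. set (fq := fun s => shift_q (g s)) in *.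
  set (fc := fun s => log_scale (g s)) in *.
  change (e12 (g s)) with (f12 s) in *.
  change (e21 (g s)) with (f21 s) in *. change (e22 (g s)) with (f22 s) in *.
  change (shift_p (g s)) with (fp s) in *. change (shift_q (g s)) with (fq s) in *.
  change (log_scale (g s)) with (fc s) in *.
  set (f11 := e11 (g s)) in *.
  match type of d12 with is_derive _ _ ?l => change (is_derive f12 s l) in d12 end.
  match type of d21 with is_derive _ _ ?l => change (is_derive f21 s l) in d21 end.
  match type of d22 with is_derive _ _ ?l => change (is_derive f22 s l) in d22 end.
  match type of dq with is_derive _ _ ?l => change (is_derive fq s l) in dq end.
  match type of dc with is_derive _ _ ?l => change (is_derive fc s l) in dc end.
  change (is_derive (fun s =>
    (2 * B ^ 2 / A - C + sqrt A / 2) * (ct s - t0)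
    + ln (f21 s * exp (sqrt A * t0) ^ 2 + f22 s) / 2
    - sqrt A / 2 * ((cx s + 2 * B / A) ^ 2 - (x0 + 2 * B / A) ^ 2)
    - sqrt A * (f21 s * exp (sqrt A * t0) ^ 2 + f22 s) * f12 s
      * (cx s + 2 * B / A) ^ 2 / exp (sqrt A * t0) ^ 2
    + sqrt A * ((f21 s * exp (sqrt A * t0) ^ 2 + f22 s) * exp (sqrt A * ct s)
      * (cx s + 2 * B / A) + exp (sqrt A * t0) * (x0 + 2 * B / A)) * fq s
      / exp (sqrt A * t0) ^ 2 + fc s) s
    (- A * (c2 * exp (sqrt A * ct s) ^ 2 + c3 / exp (sqrt A * ct s) ^ 2)
       * (cx s + 2 * B / A) ^ 2
     - sqrt A * (d * exp (sqrt A * ct s) - e / exp (sqrt A * ct s))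
       * (cx s + 2 * B / A)
     + (2 * B ^ 2 / A - C)
       * (c1 + c2 * exp (sqrt A * ct s) ^ 2 + c3 / exp (sqrt A * ct s) ^ 2)
     - sqrt A / 2 * (c2 * exp (sqrt A * ct s) ^ 2 - c3 / exp (sqrt A * ct s) ^ 2)
     + c)).
  assert (w0pos := exp_pos (sqrt A * t0)). assert (wpos := exp_pos (sqrt A * ct s)).
  set (w0 := exp (sqrt A * t0)) in *.
  set (h := 2 * B / A) in *. set (k := 2 * B ^ 2 / A - C) in *.
  set (q := sqrt A) in *.
  destruct hcar as [hl [hp hr]].
  clearbody f11 f12 f21 f22 fp fq fc q h k w0.
  clear hg hc hu h0.
  auto_derive.
  - repeat split; try (eexists; eassumption); auto.
    all: try (apply Rgt_not_eq; simpl; nra).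
  - known_derive.
    set (w := exp (q * ct s)) in *. clearbody w.
    clear d11 d12 d21 d22 dp dq dc dct dcx.
    set (y := cx s + h) in *. set (y0 := x0 + h) in *.
    clearbody y y0. revert hl hp hdet hr.
    generalize (f12 s), (f21 s), (f22 s), (fp s), (fq s).
    clear f12 f21 f22 fp fq fc cx ct g. intros a12 a21 a22 bp bq hl hp hdet hr.
    (* the relations [carries] and the determinant leave [l], [w], [w0], [y], [a12],
       [bp], [bq] as free variables *)
    set (l := a21 * w0 ^ 2 + a22) in *.
    assert (hl' : l <> 0) by lra. assert (hw' : w <> 0) by lra.
    assert (hw0' : w0 <> 0) by lra.
    assert (E11 : f11 = (l * w ^ 2 - a12) / w0 ^ 2).
    { rewrite <- hp. field. exact hw0'. }
    assert (E21 : a21 = (l - a22) / w0 ^ 2).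
    { unfold l. field. exact hw0'. }
    clearbody l. subst f11 a21.
    assert (E22 : a22 = (w0 ^ 2 / l + a12) / w ^ 2).
    { apply (Rmult_eq_reg_l (l * w ^ 2 / w0 ^ 2)).
      - transitivity (1 + l * a12 / w0 ^ 2); [| field; auto].
        rewrite <- hdet. field. exact hw0'.
      - unfold Rdiv. apply Rmult_integral_contrapositive_currified;
          [apply Rmult_integral_contrapositive_currified; [exact hl' |] |];
          [| apply Rinv_neq_0_compat]; apply pow_nonzero; assumption. }
    assert (E0 : y0 = (l * w * y - bp * w0 ^ 2 - bq) / w0).
    { rewrite hr. field. exact hw0'. }
    subst a22 y0. rewrite <- hqq.
    field. repeat split; auto.
    replace (l * (l * w ^ 2) - (w0 ^ 2 + a12 * l) + (w0 ^ 2 + a12 * l))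
      with (l * (l * w ^ 2)) by ring.
    repeat apply Rmult_integral_contrapositive_currified; auto.
Qed.

(** The inhomogeneous term [phi0] cancels in the difference of two curves above the
    same base curve, so that the difference solves the linear equation whose
    solution is the multiplier. *)
Lemma exp_maps_step (A B C : R) (theta : R -> R) (a b : Rbar) (v : vfield)
  (c1 c2 c3 d e c : R) (phi0 : R -> R -> R) (g0 : oscillator_map) :
  0 < A -> theta_equation A B C theta ->
  (forall x, between a b x -> theta x <> 0) ->
  generator A B C theta (between a b) v c1 c2 c3 d e c phi0 -> unimodular g0 ->
  exists g1, unimodular g1 /\
    forall x0 t0 x t u u' x1 t1 u1 x1' t1' u1',
      theta x0 <> 0 -> carries A B g0 x0 t0 x t ->
      exp_maps (between a b) v (x, t, u) (x1, t1, u1) ->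
      exp_maps (between a b) v (x, t, u') (x1', t1', u1') ->
      carries A B g1 x0 t0 x1 t1 /\ x1' = x1 /\ t1' = t1 /\
      (u1' - u1) / full_multiplier A B C theta g1 x0 t0 x1 t1
      = (u' - u) / full_multiplier A B C theta g0 x0 t0 x t.
Proof.
  intros hA hth h0 hgen hu.
  destruct (flow_exists A c1 c2 c3 d e c g0) as [g [hg0 hg]].
  exists (g 1). split.
  { apply (flow_unimodular A c1 c2 c3 d e c g hg). rewrite hg0. exact hu. }
  intros x0 t0 x t u u' x1 t1 u1 x1' t1' u1' hx0 hcar.
  intros [cx [ct [cu [i0 [i1 hc]]]]] [cx' [ct' [cu' [i0' [i1' hc']]]]].
  injection i0 as ix0 it0 iu0. injection i1 as ix1 it1 iu1.
  injection i0' as ix0' it0' iu0'. injection i1' as ix1' it1' iu1'.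
  assert (hbase : base_curve A B c1 c2 c3 d e cx ct).
  { intros s hs. destruct (hc s hs) as [hI [h1 [h2 _]]].
    destruct (hgen (cx s) (ct s) (cu s) hI) as [g1 [g2 _]].
    rewrite g1 in h2. rewrite g2 in h1. split; assumption. }
  assert (hbase' : base_curve A B c1 c2 c3 d e cx' ct').
  { intros s hs. destruct (hc' s hs) as [hI [h1 [h2 _]]].
    destruct (hgen (cx' s) (ct' s) (cu' s) hI) as [g1 [g2 _]].
    rewrite g1 in h2. rewrite g2 in h1. split; assumption. }
  assert (hcar0 : carries A B (g 0) x0 t0 (cx 0) (ct 0)).
  { rewrite hg0, ix0, it0. exact hcar. }
  assert (hcar0' : carries A B (g 0) x0 t0 (cx' 0) (ct' 0)).
  { rewrite hg0, ix0', it0'. exact hcar. }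
  assert (hu0 : unimodular (g 0)) by (rewrite hg0; exact hu).
  assert (F := flow_carries A B c1 c2 c3 d e c g cx ct x0 t0 hg hbase hcar0).
  assert (F' := flow_carries A B c1 c2 c3 d e c g cx' ct' x0 t0 hg hbase' hcar0').
  assert (same : forall s, 0 <= s <= 1 -> cx' s = cx s /\ ct' s = ct s).
  { intros s hs. apply (carries_unique A B (g s) x0 t0); auto. }
  set (l := fun s => log_multiplier A B C (g s) x0 t0 (cx s) (ct s)) in *.
  assert (L : forall s, 0 <= s <= 1 -> is_derive l s
    (oscillator_multiplier A B C c1 c2 c3 d e c (cx s) (ct s)))
    by (apply (flow_log_multiplier A B C c1 c2 c3 d e c g); assumption).
  assert (H := constant_on_unit
    (fun s => (cu' s - cu s) / (theta (cx s) / theta x0 * exp (l s)))).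
  specialize (H ltac:(
    intros s hs;
    destruct (hc s hs) as [hI [dcx [_ dcu]]];
    destruct (hc' s hs) as [_ [_ [_ dcu']]];
    destruct (same s hs) as [ex et]; rewrite ex, et in dcu';
    destruct (hgen (cx s) (ct s) (cu s) hI) as [_ [gx gu]];
    destruct (hgen (cx s) (ct s) (cu' s) hI) as [_ [gx' gu']];
    rewrite gu in dcu; rewrite gu' in dcu';
    rewrite gx' in dcu'; rewrite <- gx in dcu';
    specialize (L s hs);
    assert (dth := proj1 (theta_derive A B C theta (cx s) hth));
    clearbody l;
    assert (hex := exp_pos (l s)); specialize (h0 (cx s) hI);
    set (th' := Derive theta) in *;
    auto_derive;
    [ repeat split; try (eexists; eassumption);
      repeat apply Rmult_integral_contrapositive_currified;
      try apply Rinv_neq_0_compat; auto; apply Rgt_not_eq, exp_pos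
    | known_derive; unfold drift; fold th'; field;
      repeat split; auto; apply Rgt_not_eq, exp_pos ]) 1 ltac:(lra)).
  cbv beta in H. unfold l in H. rewrite hg0 in H.
  destruct (same 1 ltac:(lra)) as [ex et].
  rewrite ix0, it0, iu0, iu0', ix1, it1, iu1, iu1' in H.
  split; [| split; [| split]].
  - rewrite <- ix1, <- it1. apply F. lra.
  - rewrite <- ix1, <- ix1'. exact ex.
  - rewrite <- it1, <- it1'. exact et.
  - exact H.
Qed.

(** The flows of [oscillator_map]s start from an arbitrary element, so the maps of
    successive exponentials are composed by starting each flow where the previous
    one ended. *)
Lemma exps_map_carries (A B C : R) (theta : R -> R) (a b : Rbar)
  (vs : list vfield) (g0 : oscillator_map) (z : R) :
  0 < A -> theta_equation A B C theta ->
  (forall x, between a b x -> theta x <> 0) -> between a b z ->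
  (forall v, In v vs -> infinitesimal_symmetry theta (between a b) v) ->
  unimodular g0 ->
  exists g1, unimodular g1 /\
    forall x0 t0 x t u u' x1 t1 u1 x1' t1' u1',
      theta x0 <> 0 -> carries A B g0 x0 t0 x t ->
      exps_map (between a b) vs (x, t, u) (x1, t1, u1) ->
      exps_map (between a b) vs (x, t, u') (x1', t1', u1') ->
      carries A B g1 x0 t0 x1 t1 /\
      (u1' - u1) / full_multiplier A B C theta g1 x0 t0 x1 t1
      = (u' - u) / full_multiplier A B C theta g0 x0 t0 x t.
Proof.
  intros hA hth h0 hz. revert g0. induction vs as [| v vs IH]; intros g0 hvs hu.
  - exists g0. split; [exact hu |].
    intros x0 t0 x t u u' x1 t1 u1 x1' t1' u1' hx0 hcar e1 e2.
    simpl in e1, e2. injection e1 as -> -> ->. injection e2 as _ _ ->.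
    split; [exact hcar | reflexivity].
  - destruct (symmetry_generator A B C theta a b v z hA hth h0 hz
      (hvs v (or_introl eq_refl))) as [c1 [c2 [c3 [d [e [c [phi0 hgen]]]]]]].
    destruct (exp_maps_step A B C theta a b v c1 c2 c3 d e c phi0 g0
      hA hth h0 hgen hu) as [g1 [hu1 H1]].
    destruct (IH g1 (fun v' hv' => hvs v' (or_intror hv')) hu1) as [g2 [hu2 H2]].
    exists g2. split; [exact hu2 |].
    intros x0 t0 x t u u' x1 t1 u1 x1' t1' u1' hx0 hcar
      [[[x2 t2] u2] [e1 e2]] [[[x2' t2'] u2'] [e1' e2']].
    destruct (H1 x0 t0 x t u u' x2 t2 u2 x2' t2' u2' hx0 hcar e1 e1')
      as [hcar1 [-> [-> E]]].
    destruct (H2 x0 t0 x2 t2 u2 u2' x1 t1 u1 x1' t1' u1' hx0 hcar1 e2 e2')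
      as [hcar2 E'].
    split; [exact hcar2 |]. rewrite E', E. reflexivity.
Qed.

(** * Classical solutions *)

Definition continuous2 (F : R -> R -> R) (x t : R) : Prop :=
  continuous (fun p : R * R => F (fst p) (snd p)) (x, t).

Definition c21 (Om : R * R -> Prop) (W Wx Wxx Wt : R -> R -> R) : Prop :=
  forall x t, Om (x, t) ->
    is_derive (fun y => W y t) x (Wx x t) /\
    is_derive (fun y => Wx y t) x (Wxx x t) /\
    is_derive (fun s => W x s) t (Wt x t) /\
    continuous2 W x t /\ continuous2 Wx x t /\ continuous2 Wxx x t /\
    continuous2 Wt x t.

Lemma continuous2_plus (F G : R -> R -> R) (x t : R) :
  continuous2 F x t -> continuous2 G x t ->
  continuous2 (fun x t => F x t + G x t) x t.
Proof.
  intros hF hG. exact (continuous_plus (K := R_AbsRing) (V := R_NormedModule)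
    (fun p => F (fst p) (snd p)) (fun p => G (fst p) (snd p)) (x, t) hF hG).
Qed.

Lemma continuous2_mult (F G : R -> R -> R) (x t : R) :
  continuous2 F x t -> continuous2 G x t ->
  continuous2 (fun x t => F x t * G x t) x t.
Proof.
  intros hF hG. exact (continuous_mult (K := R_AbsRing)
    (fun p => F (fst p) (snd p)) (fun p => G (fst p) (snd p)) (x, t) hF hG).
Qed.

Lemma continuous2_x (f : R -> R) (x t : R) :
  continuous f x -> continuous2 (fun x _ => f x) x t.
Proof.
  intros hf. apply (continuous_comp (fun p : R * R => fst p) f (x, t)).
  - apply continuous_fst.
  - exact hf.
Qed.

Lemma continuous2_t (f : R -> R) (x t : R) :
  continuous f t -> continuous2 (fun _ t => f t) x t.
Proof.
  intros hf. apply (continuous_comp (fun p : R * R => snd p) f (x, t)).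
  - apply continuous_snd.
  - exact hf.
Qed.

Lemma continuous2_const (c x t : R) : continuous2 (fun _ _ => c) x t.
Proof. apply continuous2_x, continuous_const. Qed.

Lemma continuous2_comp (W X T : R -> R -> R) (x t : R) :
  continuous2 W (X x t) (T x t) -> continuous2 X x t -> continuous2 T x t ->
  continuous2 (fun x t => W (X x t) (T x t)) x t.
Proof.
  intros hW hX hT.
  exact (continuous_comp_2 (fun p => X (fst p) (snd p)) (fun p => T (fst p) (snd p))
    W (x, t) hX hT hW).
Qed.

Lemma continuous2_ext (F G : R -> R -> R) (x t : R) :
  (forall x t, F x t = G x t) -> continuous2 F x t -> continuous2 G x t.
Proof. intros e. apply continuous_ext. intros p. apply e. Qed.

Lemma continuous2_ext_loc (Om : R * R -> Prop) (F G : R -> R -> R) (x t : R) :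
  open Om -> Om (x, t) -> (forall x t, Om (x, t) -> F x t = G x t) ->
  continuous2 F x t -> continuous2 G x t.
Proof.
  intros ho h e. apply continuous_ext_loc. apply (filter_imp Om).
  - intros [y s] hy. exact (e y s hy).
  - apply ho, h.
Qed.

Lemma open_section_x (Om : R * R -> Prop) (x t : R) :
  open Om -> Om (x, t) -> locally x (fun y => Om (y, t)).
Proof.
  intros ho h. apply (locally_2d_1d_const_y (fun y s => Om (y, s))).
  apply locally_2d_locally. apply (filter_imp Om); [| apply ho, h].
  intros [y s]. auto.
Qed.

Lemma open_section_t (Om : R * R -> Prop) (x t : R) :
  open Om -> Om (x, t) -> locally t (fun s => Om (x, s)).
Proof.
  intros ho h. apply (locally_2d_1d_const_x (fun y s => Om (y, s))).
  apply locally_2d_locally. apply (filter_imp Om); [| apply ho, h].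
  intros [y s]. auto.
Qed.

Lemma c21_ext (Om : R * R -> Prop) (W W' Wx Wxx Wt : R -> R -> R) :
  open Om -> (forall x t, Om (x, t) -> W x t = W' x t) ->
  c21 Om W Wx Wxx Wt -> c21 Om W' Wx Wxx Wt.
Proof.
  intros ho e h x t hx. destruct (h x t hx) as [h1 [h2 [h3 [h4 h5]]]].
  split; [| split; [| split; [| split]]]; auto.
  - apply (is_derive_ext_loc (fun y => W y t)); [| exact h1].
    apply (filter_imp (fun y => Om (y, t))); [| apply open_section_x; auto]. auto.
  - apply (is_derive_ext_loc (fun s => W x s)); [| exact h3].
    apply (filter_imp (fun s => Om (x, s))); [| apply open_section_t; auto]. auto.
  - apply (continuous2_ext_loc Om W W'); auto.
Qed.

Lemma c21_mult (Om : R * R -> Prop) (F Fx Fxx Ft G Gx Gxx Gt : R -> R -> R) :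
  c21 Om F Fx Fxx Ft -> c21 Om G Gx Gxx Gt ->
  c21 Om (fun x t => F x t * G x t)
    (fun x t => Fx x t * G x t + F x t * Gx x t)
    (fun x t => Fxx x t * G x t + 2 * (Fx x t * Gx x t) + F x t * Gxx x t)
    (fun x t => Ft x t * G x t + F x t * Gt x t).
Proof.
  intros hF hG x t hx.
  destruct (hF x t hx) as [f1 [f2 [f3 [f4 [f5 [f6 f7]]]]]].
  destruct (hG x t hx) as [g1 [g2 [g3 [g4 [g5 [g6 g7]]]]]].
  split; [| split; [| split; [| split; [| split; [| split]]]]].
  - auto_derive; [repeat split; eexists; eassumption |]. known_derive. ring.
  - auto_derive; [repeat split; eexists; eassumption |]. known_derive. ring.
  - auto_derive; [repeat split; eexists; eassumption |]. known_derive. ring.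
  - apply continuous2_mult; assumption.
  - apply continuous2_plus; apply continuous2_mult; assumption.
  - apply (continuous2_plus
      (fun x t => Fxx x t * G x t + 2 * (Fx x t * Gx x t)) (fun x t => F x t * Gxx x t));
      [| apply continuous2_mult; assumption].
    apply (continuous2_plus
      (fun x t => Fxx x t * G x t) (fun x t => 2 * (Fx x t * Gx x t)));
      [apply continuous2_mult; assumption |].
    apply (continuous2_mult (fun _ _ => 2) (fun x t => Fx x t * Gx x t));
      [apply continuous2_const | apply continuous2_mult; assumption].
  - apply continuous2_plus; apply continuous2_mult; assumption.
Qed.

(** Continuous partial derivatives give the two-variable chain rule. *)
Lemma c21_differentiable (Om : R * R -> Prop) (W Wx Wxx Wt : R -> R -> R) (x t : R) :
  open Om -> c21 Om W Wx Wxx Wt -> Om (x, t) ->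
  differentiable_pt_lim W x t (Wx x t) (Wt x t).
Proof.
  intros ho h hx. apply filterdiff_differentiable_pt_lim.
  destruct (h x t hx) as [_ [_ [h3 [_ [h5 _]]]]].
  apply (is_derive_filterdiff W x t Wx (Wt x t)).
  - apply (filter_imp Om); [| apply ho, hx]. intros [y s] hy. apply (h y s hy).
  - exact h3.
  - exact h5.
Qed.

Lemma c21_comp_affine (Om : R * R -> Prop) (J : R -> Prop)
  (W Wx Wxx Wt : R -> R -> R) (sg sg1 s s1 T T1 : R -> R) :
  open Om -> c21 Om W Wx Wxx Wt ->
  (forall t, J t -> is_derive sg t (sg1 t) /\ is_derive s t (s1 t) /\
     is_derive T t (T1 t) /\ continuous sg1 t /\ continuous s1 t /\ continuous T1 t) ->
  c21 (fun p => J (snd p) /\ Om (sg (snd p) * fst p + s (snd p), T (snd p)))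
    (fun x t => W (sg t * x + s t) (T t))
    (fun x t => sg t * Wx (sg t * x + s t) (T t))
    (fun x t => sg t * (sg t * Wxx (sg t * x + s t) (T t)))
    (fun x t => Wx (sg t * x + s t) (T t) * (sg1 t * x + s1 t)
                + Wt (sg t * x + s t) (T t) * T1 t).
Proof.
  intros ho h hJ x t [hj hx]. simpl in hj, hx.
  destruct (hJ t hj) as [d1 [d2 [d3 [k1 [k2 k3]]]]].
  destruct (h _ _ hx) as [h1 [h2 [h3 [h4 [h5 [h6 h7]]]]]].
  assert (cX : continuous2 (fun x t => sg t * x + s t) x t).
  { apply (continuous2_plus (fun x t => sg t * x) (fun _ t => s t)).
    - apply (continuous2_mult (fun _ t => sg t) (fun x _ => x)).
      + exact (continuous2_t sg x t (is_derive_continuous _ _ _ d1)).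
      + apply continuous2_x, continuous_id.
    - exact (continuous2_t s x t (is_derive_continuous _ _ _ d2)). }
  assert (cT := continuous2_t T x t (is_derive_continuous _ _ _ d3)).
  assert (csg := continuous2_t sg x t (is_derive_continuous _ _ _ d1)).
  assert (cc : forall V, continuous2 V (sg t * x + s t) (T t) ->
    continuous2 (fun x t => V (sg t * x + s t) (T t)) x t).
  { intros V hV. exact (continuous2_comp V _ (fun _ t => T t) x t hV cX cT). }
  split; [| split; [| split; [| split; [| split; [| split]]]]].
  - apply (is_derive_comp (fun y => W y (T t)) (fun y => sg t * y + s t)).
    + exact h1.
    + auto_derive; [trivial |]. ring.
  - apply (is_derive_scal (fun y => Wx (sg t * y + s t) (T t))).
    apply (is_derive_comp (fun y => Wx y (T t)) (fun y => sg t * y + s t)).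
    + exact h2.
    + auto_derive; [trivial |]. ring.
  - apply is_derive_Reals.
    apply (derivable_pt_lim_comp_2d W (fun t => sg t * x + s t) T).
    + apply (c21_differentiable Om W Wx Wxx Wt); assumption.
    + apply is_derive_Reals. derive. ring.
    + apply is_derive_Reals. exact d3.
  - apply cc, h4.
  - apply (continuous2_mult (fun _ t => sg t)); [exact csg |]. apply cc, h5.
  - apply (continuous2_mult (fun _ t => sg t)); [exact csg |].
    apply (continuous2_mult (fun _ t => sg t)); [exact csg |]. apply cc, h6.
  - apply (continuous2_plus (fun x t => Wx (sg t * x + s t) (T t) * (sg1 t * x + s1 t))
      (fun x t => Wt (sg t * x + s t) (T t) * T1 t)).
    + apply (continuous2_mult (fun x t => Wx (sg t * x + s t) (T t))
        (fun x t => sg1 t * x + s1 t)); [apply cc, h5 |].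
      apply (continuous2_plus (fun x t => sg1 t * x) (fun _ t => s1 t)).
      * apply (continuous2_mult (fun _ t => sg1 t) (fun x _ => x)).
        -- exact (continuous2_t sg1 x t k1).
        -- apply continuous2_x, continuous_id.
      * exact (continuous2_t s1 x t k2).
    + apply (continuous2_mult (fun x t => Wt (sg t * x + s t) (T t)) (fun _ t => T1 t));
        [apply cc, h7 | exact (continuous2_t T1 x t k3)].
Qed.

Lemma c21_exp (Om : R * R -> Prop) (F Fx Fxx Ft : R -> R -> R) :
  c21 Om F Fx Fxx Ft ->
  c21 Om (fun x t => exp (F x t)) (fun x t => Fx x t * exp (F x t))
    (fun x t => (Fxx x t + Fx x t * Fx x t) * exp (F x t))
    (fun x t => Ft x t * exp (F x t)).
Proof.
  intros h x t hx. destruct (h x t hx) as [f1 [f2 [f3 [f4 [f5 [f6 f7]]]]]].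
  assert (ce : continuous2 (fun x t => exp (F x t)) x t).
  { apply (continuous2_comp (fun z _ => exp z) F (fun _ _ => 0)); auto.
    - apply continuous2_x.
      apply (is_derive_continuous exp (F x t) (exp (F x t))), is_derive_exp.
    - apply continuous2_const. }
  split; [| split; [| split; [| split; [| split; [| split]]]]].
  - derive. ring.
  - auto_derive; [repeat split; eexists; eassumption |]. known_derive. ring.
  - derive. ring.
  - exact ce.
  - apply continuous2_mult; assumption.
  - apply (continuous2_mult (fun x t => Fxx x t + Fx x t * Fx x t)); [| exact ce].
    apply continuous2_plus; [| apply continuous2_mult]; assumption.
  - apply continuous2_mult; assumption.
Qed.

Lemma c21_quadratic (Om : R * R -> Prop) (J : R -> Prop) (h : R)
  (a2 b2 a1 b1 a0 b0 : R -> R) :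
  (forall p, Om p -> J (snd p)) ->
  (forall t, J t -> is_derive a2 t (b2 t) /\ is_derive a1 t (b1 t) /\
     is_derive a0 t (b0 t) /\ continuous b2 t /\ continuous b1 t /\ continuous b0 t) ->
  c21 Om (fun x t => a2 t * (x + h) ^ 2 + a1 t * (x + h) + a0 t)
    (fun x t => 2 * a2 t * (x + h) + a1 t) (fun x t => 2 * a2 t)
    (fun x t => b2 t * (x + h) ^ 2 + b1 t * (x + h) + b0 t).
Proof.
  intros hO hJ x t hx.
  destruct (hJ t (hO _ hx)) as [d2 [d1 [d0 [k2 [k1 k0]]]]].
  assert (cq : forall f, continuous f t -> continuous2 (fun _ t => f t) x t)
    by (intros f hf; exact (continuous2_t f x t hf)).
  assert (c2 := is_derive_continuous _ _ _ d2).
  assert (c1 := is_derive_continuous _ _ _ d1).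
  assert (c0 := is_derive_continuous _ _ _ d0).
  assert (cp : forall f : R -> R, (forall y, ex_derive f y) ->
    continuous2 (fun x _ => f x) x t).
  { intros f hf. apply continuous2_x.
    destruct (hf x) as [l hl]. exact (is_derive_continuous f x l hl). }
  assert (cx1 : continuous2 (fun x _ => x + h) x t).
  { apply (cp (fun x => x + h)). intros y. auto_derive. trivial. }
  assert (cx2 : continuous2 (fun x _ => (x + h) ^ 2) x t).
  { apply (cp (fun x => (x + h) ^ 2)). intros y. auto_derive. trivial. }
  assert (cquad : forall f2 f1 f0, continuous f2 t -> continuous f1 t ->
    continuous f0 t ->
    continuous2 (fun x t => f2 t * (x + h) ^ 2 + f1 t * (x + h) + f0 t) x t).
  { intros f2 f1 f0 e2 e1 e0.
    apply (continuous2_plus (fun x t => f2 t * (x + h) ^ 2 + f1 t * (x + h))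
      (fun _ t => f0 t)); [| auto].
    apply (continuous2_plus (fun x t => f2 t * (x + h) ^ 2)
      (fun x t => f1 t * (x + h))).
    - apply (continuous2_mult (fun _ t => f2 t) (fun x _ => (x + h) ^ 2)); auto.
    - apply (continuous2_mult (fun _ t => f1 t) (fun x _ => x + h)); auto. }
  assert (c22 : continuous2 (fun _ t => 2 * a2 t) x t).
  { apply (continuous2_mult (fun _ _ => 2) (fun _ t => a2 t));
      [apply continuous2_const | auto]. }
  split; [| split; [| split; [| split; [| split; [| split]]]]].
  - auto_derive; [trivial |]. ring.
  - auto_derive; [trivial |]. ring.
  - derive. ring.
  - apply cquad; assumption.
  - apply (continuous2_plus (fun x t => 2 * a2 t * (x + h)) (fun _ t => a1 t)); [| auto].
    apply (continuous2_mult (fun _ t => 2 * a2 t) (fun x _ => x + h)); auto.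
  - exact c22.
  - apply cquad; assumption.
Qed.

Definition fpk_equation (A B C : R) (theta : R -> R) (Om : R * R -> Prop)
  (W Wx Wxx Wt : R -> R -> R) : Prop :=
  forall x t, Om (x, t) ->
    Wt x t = / 2 * Wxx x t
             - ((potential A B C x - drift theta x ^ 2) * W x t
                + drift theta x * Wx x t).

Definition oscillator_equation (A B C : R) (Om : R * R -> Prop)
  (W Wxx Wt : R -> R -> R) : Prop :=
  forall x t, Om (x, t) ->
    Wt x t = / 2 * Wxx x t - / 2 * potential A B C x * W x t.

Lemma flux_derive (A B C : R) (theta : R -> R) (f : R -> R) (x l : R) :
  theta_equation A B C theta -> theta x <> 0 -> is_derive f x l ->
  Derive (fun y => drift theta y * f y) x
  = (potential A B C x - drift theta x ^ 2) * f x + drift theta x * l.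
Proof.
  intros hth h0 hf. assert (hm := drift_derive A B C theta x hth h0).
  apply is_derive_unique. set (m := drift theta) in *. derive. ring.
Qed.

Lemma c21_solution (A B C : R) (theta : R -> R) (a b : Rbar) (Om : R * R -> Prop)
  (W Wx Wxx Wt : R -> R -> R) :
  theta_equation A B C theta -> (forall x, between a b x -> theta x <> 0) ->
  open_in_strip (between a b) Om -> c21 Om W Wx Wxx Wt ->
  fpk_equation A B C theta Om W Wx Wxx Wt -> solution_on theta Om W.
Proof.
  intros hth h0 [ho hI] h e x t hx.
  set (Ux := fun x t => Derive (fun y => W y t) x).
  set (Uxx := fun x t => Derive (fun y => Ux y t) x).
  set (Ut := fun x t => Derive (fun s => W x s) t).
  assert (ex : forall x t, Om (x, t) -> Wx x t = Ux x t).
  { intros y s hy. symmetry. apply is_derive_unique. apply (h y s hy). }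
  assert (dxx : forall x t, Om (x, t) -> is_derive (fun y => Ux y t) x (Wxx x t)).
  { intros y s hy. apply (is_derive_ext_loc (fun z => Wx z s)).
    - apply (filter_imp (fun z => Om (z, s))); [| apply open_section_x; auto].
      intros z hz. apply ex, hz.
    - apply (h y s hy). }
  assert (exx : forall x t, Om (x, t) -> Wxx x t = Uxx x t).
  { intros y s hy. symmetry. apply is_derive_unique. apply dxx, hy. }
  assert (et : forall x t, Om (x, t) -> Wt x t = Ut x t).
  { intros y s hy. symmetry. apply is_derive_unique. apply (h y s hy). }
  destruct (h x t hx) as [h1 [h2 [h3 [h4 [h5 [h6 h7]]]]]].
  split; [| split; [| split; [| split; [| split; [| split]]]]].
  - exists (Wx x t). exact h1.
  - exists (Wxx x t). apply dxx, hx.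
  - exists (Wt x t). exact h3.
  - exact (continuous2_ext_loc Om Wx Ux x t ho hx ex h5).
  - exact (continuous2_ext_loc Om Wxx Uxx x t ho hx exx h6).
  - exact (continuous2_ext_loc Om Wt Ut x t ho hx et h7).
  - change (Ut x t = / 2 * Uxx x t - Derive (fun y => drift theta y * W y t) x).
    rewrite <- (et x t hx), <- (exx x t hx), (e x t hx). f_equal. symmetry.
    apply (flux_derive A B C theta (fun y => W y t)); [exact hth | apply h0, (hI _ hx) | exact h1].
Qed.

Lemma solution_c21 (A B C : R) (theta : R -> R) (a b : Rbar) (Om : R * R -> Prop)
  (U : R -> R -> R) :
  theta_equation A B C theta -> (forall x, between a b x -> theta x <> 0) ->
  open_in_strip (between a b) Om -> solution_on theta Om U ->
  exists Ux Uxx Ut, c21 Om U Ux Uxx Ut /\ fpk_equation A B C theta Om U Ux Uxx Ut.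
Proof.
  intros hth h0 [ho hI] h.
  exists (fun x t => Derive (fun y => U y t) x),
    (fun x t => Derive (fun y => Derive (fun z => U z t) y) x),
    (fun x t => Derive (fun s => U x s) t).
  split; intros x t hx; destruct (h x t hx) as [h1 [h2 [h3 [h4 [h5 [h6 e]]]]]].
  - split; [| split; [| split; [| split; [| split; [| split]]]]];
      try assumption; try (apply Derive_correct; assumption).
    apply (filterdiff_continuous (K := R_AbsRing)
      (U := prod_NormedModule _ R_NormedModule R_NormedModule) (V := R_NormedModule)
      (fun p => U (fst p) (snd p)) (x, t)).
    eexists.
    apply (is_derive_filterdiff U x t (fun x t => Derive (fun y => U y t) x)
      (Derive (fun s => U x s) t)).
    + apply (filter_imp Om); [| apply ho, hx]. intros [y s] hy.
      apply Derive_correct. apply (h y s hy).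
    + apply Derive_correct, h3.
    + exact h4.
  - rewrite e. f_equal. apply (flux_derive A B C theta (fun y => U y t));
      [exact hth | apply h0, (hI _ hx) | apply Derive_correct, h1].
Qed.

Lemma c21_theta (A B C : R) (theta : R -> R) (Om : R * R -> Prop) :
  theta_equation A B C theta ->
  c21 Om (fun x _ => theta x) (fun x _ => Derive theta x)
    (fun x _ => potential A B C x * theta x) (fun _ _ => 0).
Proof.
  intros hth x t _. destruct (theta_derive A B C theta x hth) as [h1 h2].
  assert (c1 := is_derive_continuous _ _ _ h1).
  split; [| split; [| split; [| split; [| split; [| split]]]]].
  - exact h1.
  - exact h2.
  - auto_derive; trivial.
  - apply continuous2_x, c1.
  - apply continuous2_x. exact (is_derive_continuous _ _ _ h2).
  - apply (continuous2_mult (fun x _ => potential A B C x) (fun x _ => theta x)).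
    + apply continuous2_x. unfold potential.
      apply (is_derive_continuous (fun x => A * x ^ 2 + 4 * B * x + 2 * C) x
        (2 * A * x + 4 * B)). auto_derive; [trivial |]. ring.
    + apply continuous2_x, c1.
  - apply continuous2_const.
Qed.

Lemma c21_inv_theta (A B C : R) (theta : R -> R) (a b : Rbar) (Om : R * R -> Prop) :
  theta_equation A B C theta -> (forall x, between a b x -> theta x <> 0) ->
  open_in_strip (between a b) Om ->
  c21 Om (fun x _ => / theta x) (fun x _ => - drift theta x / theta x)
    (fun x _ => (2 * drift theta x ^ 2 - potential A B C x) / theta x)
    (fun _ _ => 0).
Proof.
  intros hth h0 [_ hI] x t hx. specialize (h0 x (hI _ hx)).
  destruct (theta_derive A B C theta x hth) as [h1 _].
  assert (h2 := drift_derive A B C theta x hth h0).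
  assert (e1 : Derive theta x = drift theta x * theta x).
  { unfold drift. field. exact h0. }
  rewrite e1 in h1. set (m := drift theta) in *.
  assert (d0 : is_derive (fun y => / theta y) x (- m x / theta x)).
  { derive; [exact h0 |]. field. exact h0. }
  assert (d1 : is_derive (fun y => - m y / theta y) x
    ((2 * m x ^ 2 - potential A B C x) / theta x)).
  { derive; [exact h0 |]. field. exact h0. }
  assert (d2 : is_derive (fun y => (2 * m y ^ 2 - potential A B C y) / theta y) x
    ((4 * m x * (potential A B C x - m x ^ 2) - (2 * A * x + 4 * B)
      - m x * (2 * m x ^ 2 - potential A B C x)) / theta x)).
  { unfold potential in *. auto_derive; [known_ex_derive; exact h0 |].
    known_derive. field. exact h0. }
  split; [| split; [| split; [| split; [| split; [| split]]]]].
  - exact d0.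
  - exact d1.
  - auto_derive; trivial.
  - apply (continuous2_x (fun y => / theta y)). exact (is_derive_continuous _ _ _ d0).
  - apply (continuous2_x (fun y => - m y / theta y)).
    exact (is_derive_continuous _ _ _ d1).
  - apply (continuous2_x (fun y => (2 * m y ^ 2 - potential A B C y) / theta y)).
    exact (is_derive_continuous _ _ _ d2).
  - apply continuous2_const.
Qed.

(** Doob's transform: the drift being a logarithmic derivative, dividing by [theta]
    cancels the first-order term, and the Riccati equation of the drift leaves the
    quadratic potential. *)
Lemma fpk_to_oscillator (A B C : R) (theta : R -> R) (a b : Rbar)
  (Om : R * R -> Prop) (U Ux Uxx Ut : R -> R -> R) :
  theta_equation A B C theta -> (forall x, between a b x -> theta x <> 0) ->
  open_in_strip (between a b) Om ->
  c21 Om U Ux Uxx Ut -> fpk_equation A B C theta Om U Ux Uxx Ut ->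
  exists Wx Wxx Wt, c21 Om (fun x t => / theta x * U x t) Wx Wxx Wt /\
    oscillator_equation A B C Om (fun x t => / theta x * U x t) Wxx Wt.
Proof.
  intros hth h0 hO hU e.
  assert (hi := c21_inv_theta A B C theta a b Om hth h0 hO).
  eexists. eexists. eexists.
  split; [exact (c21_mult Om _ _ _ _ _ _ _ _ hi hU) |].
  intros x t hx. cbv beta. rewrite (e x t hx). field. apply h0, (proj2 hO _ hx).
Qed.

Lemma oscillator_to_fpk (A B C : R) (theta : R -> R) (a b : Rbar)
  (Om : R * R -> Prop) (W Wx Wxx Wt : R -> R -> R) :
  theta_equation A B C theta -> (forall x, between a b x -> theta x <> 0) ->
  open_in_strip (between a b) Om ->
  c21 Om W Wx Wxx Wt -> oscillator_equation A B C Om W Wxx Wt ->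
  exists Ux Uxx Ut, c21 Om (fun x t => theta x * W x t) Ux Uxx Ut /\
    fpk_equation A B C theta Om (fun x t => theta x * W x t) Ux Uxx Ut.
Proof.
  intros hth h0 hO hW e.
  assert (hi := c21_theta A B C theta Om hth).
  eexists. eexists. eexists.
  split; [exact (c21_mult Om _ _ _ _ _ _ _ _ hi hW) |].
  intros x t hx. cbv beta. rewrite (e x t hx). unfold drift. field.
  apply h0, (proj2 hO _ hx).
Qed.

(** * The explicit families are symmetries *)

(** With [y = x + 2 B / A], the substitution
    [w = exp (a2 y ^ 2 + a1 y + a0) W (sg y + s - 2 B / A, T)] preserves the oscillator
    equation as soon as the coefficients of [W_t], of [W_x] and of the powers of [y]
    match. *)
Definition preserves_oscillator (A k : R) (J : R -> Prop)
  (sg s T a2 a1 a0 : R -> R) : Prop :=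
  forall t, J t ->
    is_derive T t (sg t ^ 2) /\
    is_derive sg t (2 * a2 t * sg t) /\
    is_derive s t (a1 t * sg t) /\
    is_derive a2 t (2 * a2 t ^ 2 - A / 2 + A / 2 * sg t ^ 4) /\
    is_derive a1 t (2 * a2 t * a1 t + A * sg t ^ 3 * s t) /\
    is_derive a0 t (a2 t + a1 t ^ 2 / 2 + k - k * sg t ^ 2
                    + A / 2 * sg t ^ 2 * s t ^ 2).

Lemma oscillator_symmetry (A B C : R) (J : R -> Prop) (sg s T a2 a1 a0 : R -> R)
  (Om : R * R -> Prop) (W Wx Wxx Wt : R -> R -> R) :
  0 < A -> preserves_oscillator A (2 * B ^ 2 / A - C) J sg s T a2 a1 a0 ->
  open Om -> c21 Om W Wx Wxx Wt -> oscillator_equation A B C Om W Wxx Wt ->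
  let h := 2 * B / A in
  let X := fun x t => sg t * x + (sg t * h + s t - h) in
  let w := fun x t =>
    exp (a2 t * (x + h) ^ 2 + a1 t * (x + h) + a0 t) * W (X x t) (T t) in
  let Om' := fun p => J (snd p) /\ Om (X (fst p) (snd p), T (snd p)) in
  exists wx wxx wt, c21 Om' w wx wxx wt /\ oscillator_equation A B C Om' w wxx wt.
Proof.
  intros hA hJ ho hW e h X w Om'.
  assert (hc : forall t, J t -> continuous sg t /\ continuous s t /\
    continuous a2 t /\ continuous a1 t).
  { intros t ht. destruct (hJ t ht) as [_ [d1 [d2 [d3 [d4 _]]]]].
    split; [| split; [| split]]; eapply is_derive_continuous; eassumption. }
  assert (hpoly : forall (f : R -> R) t, ex_derive f t -> continuous f t).
  { intros f t [l hl]. exact (is_derive_continuous f t l hl). }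
  assert (H1 := c21_comp_affine Om J W Wx Wxx Wt sg (fun t => 2 * a2 t * sg t)
    (fun t => sg t * h + s t - h) (fun t => 2 * a2 t * sg t * h + a1 t * sg t)
    T (fun t => sg t ^ 2) ho hW).
  specialize (H1 ltac:(intros t ht; destruct (hJ t ht) as [d0 [d1 [d2 [d3 [d4 d5]]]]];
    split; [exact d1 |]; split; [derive; ring |]; split; [exact d0 |];
    split; [| split]; apply hpoly; auto_derive;
    repeat split; eexists; eassumption)).
  assert (H2 := c21_quadratic Om' J h a2
    (fun t => 2 * a2 t ^ 2 - A / 2 + A / 2 * sg t ^ 4) a1
    (fun t => 2 * a2 t * a1 t + A * sg t ^ 3 * s t) a0
    (fun t => a2 t + a1 t ^ 2 / 2 + (2 * B ^ 2 / A - C)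
      - (2 * B ^ 2 / A - C) * sg t ^ 2 + A / 2 * sg t ^ 2 * s t ^ 2)).
  specialize (H2 ltac:(intros p hp; apply hp)).
  specialize (H2 ltac:(intros t ht; destruct (hJ t ht) as [d0 [d1 [d2 [d3 [d4 d5]]]]];
    split; [exact d3 |]; split; [exact d4 |]; split; [exact d5 |];
    split; [| split]; apply hpoly; auto_derive;
    repeat split; eexists; eassumption)).
  apply c21_exp in H2.
  eexists. eexists. eexists.
  split; [exact (c21_mult Om' _ _ _ _ _ _ _ _ H2 H1) |].
  intros x t [ht hx]. simpl in ht, hx. cbv beta. unfold w.
  change (sg t * x + (sg t * h + s t - h)) with (X x t).
  rewrite (e (X x t) (T t) hx).
  generalize (exp (a2 t * (x + h) ^ 2 + a1 t * (x + h) + a0 t)).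
  generalize (W (X x t) (T t)), (Wx (X x t) (T t)), (Wxx (X x t) (T t)).
  intros vxx vx v E. unfold X, potential, h. field. lra.
Qed.

Lemma locally_pair (X T : R -> R -> R) (Om : R * R -> Prop) (x t : R) :
  continuous2 X x t -> continuous2 T x t -> locally (X x t, T x t) Om ->
  locally (x, t) (fun p => Om (X (fst p) (snd p), T (fst p) (snd p))).
Proof.
  intros hX hT [eps H].
  assert (h1 : locally (x, t) (fun p => ball (X x t) eps (X (fst p) (snd p))))
    by exact (hX _ (locally_ball (X x t) eps)).
  assert (h2 : locally (x, t) (fun p => ball (T x t) eps (T (fst p) (snd p))))
    by exact (hT _ (locally_ball (T x t) eps)).
  generalize (filter_and _ _ h1 h2). apply filter_imp.
  intros p [e1 e2]. apply H. split; assumption.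
Qed.

(** The solution [U] is divided by [theta], transformed as a solution of the
    oscillator, and multiplied by [theta] again. *)
Lemma oscillator_symmetry_on (A B C : R) (theta : R -> R) (a b : Rbar)
  (J : R -> Prop) (sg s T a2 a1 a0 : R -> R) (g : transf) :
  0 < A -> theta_equation A B C theta ->
  (forall x, between a b x -> theta x <> 0) ->
  (forall t, J t -> locally t J) ->
  preserves_oscillator A (2 * B ^ 2 / A - C) J sg s T a2 a1 a0 ->
  let h := 2 * B / A in
  (forall t, time g t = T t) ->
  (forall x t, space g x t = sg t * x + (sg t * h + s t - h)) ->
  (forall x t, J t -> multiplier g x t = theta x / theta (space g x t)
     * exp (a2 t * (x + h) ^ 2 + a1 t * (x + h) + a0 t)) ->
  symmetry_on theta (between a b)
    (fun p => J (snd p) /\ between a b (fst p) /\ between a b (space g (fst p) (snd p)))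
    g.
Proof.
  intros hA hth h0 hJo hJ h gT gX gM. split; [intros x t [_ hx]; exact hx |].
  intros Om U hO hU.
  set (X := fun x t => sg t * x + (sg t * h + s t - h)).
  set (Om' := fun p : R * R =>
    (J (snd p) /\ between a b (fst p) /\ between a b (space g (fst p) (snd p))) /\
    Om (space g (fst p) (snd p), time g (snd p))).
  assert (ho : open Om').
  { intros [x t] [[hj [hx hX]] hom]. simpl in hj, hx, hX, hom.
    destruct (hJ t hj) as [d0 [d1 [d2 _]]].
    assert (cT := continuous2_t T x t (is_derive_continuous _ _ _ d0)).
    assert (cX : continuous2 X x t).
    { apply (continuous2_plus (fun x t => sg t * x) (fun _ t => sg t * h + s t - h)).
      - apply (continuous2_mult (fun _ t => sg t) (fun x _ => x)).
        + exact (continuous2_t sg x t (is_derive_continuous _ _ _ d1)).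
        + apply continuous2_x, continuous_id.
      - apply (continuous2_t (fun t => sg t * h + s t - h)).
        apply (is_derive_continuous _ _ (2 * a2 t * sg t * h + a1 t * sg t)).
        derive. ring. }
    assert (cX' : continuous2 (space g) x t).
    { apply (continuous2_ext X); [intros; symmetry; apply gX | exact cX]. }
    assert (cT' : continuous2 (fun _ t => time g t) x t).
    { apply (continuous2_ext (fun _ t => T t)); [intros; symmetry; apply gT | exact cT]. }
    assert (l1 : locally (x, t) (fun p => J (snd p)))
      by exact (continuous_snd x t J (hJo t hj)).
    assert (l2 : locally (x, t) (fun p => between a b (fst p)))
      by exact (continuous_fst x t (between a b) (locally_between a b x hx)).
    assert (l3 : locally (x, t) (fun p => between a b (space g (fst p) (snd p))))
      by exact (cX' (between a b) (locally_between a b _ hX)).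
    assert (l4 := locally_pair (space g) (fun _ t => time g t) Om x t cX' cT'
      (proj1 hO _ hom)).
    generalize (filter_and _ _ (filter_and _ _ l1 (filter_and _ _ l2 l3)) l4).
    apply filter_imp. intros p hp. exact hp. }
  assert (hI : open_in_strip (between a b) Om').
  { split; [exact ho |]. intros p [[_ [hp _]] _]. exact hp. }
  destruct (solution_c21 A B C theta a b Om U hth h0 hO hU)
    as [Ux [Uxx [Ut [hc he]]]].
  destruct (fpk_to_oscillator A B C theta a b Om U Ux Uxx Ut hth h0 hO hc he)
    as [Wx [Wxx [Wt [hW eW]]]].
  destruct (oscillator_symmetry A B C J sg s T a2 a1 a0 Om _ Wx Wxx Wt hA hJ
    (proj1 hO) hW eW) as [wx [wxx [wt [hw ew]]]].
  assert (hsub : forall p, Om' p ->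
    J (snd p) /\ Om (X (fst p) (snd p), T (snd p))).
  { intros p [[hj _] hp]. split; [exact hj |]. unfold X. rewrite <- gX, <- gT.
    exact hp. }
  assert (hw' := fun x t hp => hw x t (hsub (x, t) hp)).
  assert (ew' := fun x t hp => ew x t (hsub (x, t) hp)).
  destruct (oscillator_to_fpk A B C theta a b Om' _ wx wxx wt hth h0 hI hw' ew')
    as [ux [uxx [ut [hu eu]]]].
  assert (E : forall x t, Om' (x, t) ->
    theta x * (exp (a2 t * (x + h) ^ 2 + a1 t * (x + h) + a0 t)
      * (/ theta (X x t) * U (X x t) (T t))) = Defs.apply g U x t).
  { intros x t [[hj [_ hX]] _]. unfold Defs.apply. rewrite (gM x t hj), (gT t), gX.
    fold (X x t). field. apply h0. unfold X. rewrite <- gX. exact hX. }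
  apply (c21_solution A B C theta a b Om' _ ux uxx ut hth h0 hI).
  - exact (c21_ext Om' _ _ ux uxx ut ho E hu).
  - intros x t hp. rewrite <- (E x t hp). apply eu, hp.
Qed.

Lemma exp_double (q t : R) :
  exp (2 * q * t) = exp (q * t) ^ 2 /\ exp (- 2 * q * t) = / exp (q * t) ^ 2 /\
  exp (- q * t) = / exp (q * t).
Proof.
  split; [| split].
  - simpl. rewrite Rmult_1_r, <- exp_plus. f_equal. ring.
  - simpl. rewrite Rmult_1_r, <- exp_plus, <- exp_Ropp. f_equal. ring.
  - rewrite <- exp_Ropp. f_equal. ring.
Qed.

Lemma sqrt_pow2_pos (A : R) : 0 < A -> 0 < sqrt A /\ sqrt A ^ 2 = A.
Proof.
  intros hA. split; [apply sqrt_lt_R0, hA |].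
  rewrite <- Rsqr_pow2. apply Rsqr_sqrt. lra.
Qed.

Lemma s2_preserves_oscillator (A k alpha beta : R) :
  0 < A ->
  let q := sqrt A in
  let p := fun t => q / 2 * (alpha * exp (q * t) - beta * exp (- q * t)) in
  let s := fun t => - alpha * exp (q * t) - beta * exp (- q * t) in
  preserves_oscillator A k (fun _ => True) (fun _ => 1) s (fun t => t)
    (fun _ => 0) (fun t => - 2 * p t) (fun t => - p t * s t).
Proof.
  intros hA q p s t _. destruct (sqrt_pow2_pos A hA) as [hq hqq]. fold q in hq, hqq.
  assert (dp : is_derive p t (- (A / 2) * s t)).
  { unfold p, s. rewrite <- hqq. auto_derive; [trivial |]. field. }
  assert (ds : is_derive s t (- 2 * p t)).
  { unfold p, s. auto_derive; [trivial |]. field. }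
  clearbody p s.
  split; [| split; [| split; [| split; [| split]]]].
  - auto_derive; [trivial | ring].
  - auto_derive; [trivial | ring].
  - replace (- 2 * p t * 1) with (- 2 * p t) by ring. exact ds.
  - auto_derive; [trivial | field].
  - derive. field.
  - derive. field.
Qed.

(** Everything follows from [T1' = (alpha + beta + 1) / (Tplus Tminus)] and the
    relation [Tplus Tminus + alpha + beta + 1 = (beta + 1) Tplus + (alpha + 1) Tminus]
    between the two exponential polynomials: [sg ^ 2 = T1'], [4 a2 = T1'' / T1'], and
    [exp a0] is, up to a constant, [T1' ^ (1/4) exp (k (t - T1))]. *)
Lemma s1_preserves_oscillator (A B C alpha beta : R) :
  0 < A ->
  let q := sqrt A in
  let Tp := Tplus A alpha beta in
  let Tm := Tminus A alpha beta in
  preserves_oscillator A (2 * B ^ 2 / A - C) (letter_time A (L1 alpha beta))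
    (fun t => sqrt (alpha + beta + 1) / sqrt (Tp t * Tm t)) (fun _ => 0)
    (T1 A alpha beta)
    (fun t => - q * ((beta + 1) * Tp t - (alpha + 1) * Tm t) / (2 * Tp t * Tm t))
    (fun _ => 0)
    (fun t => nu A B C * ln (Tp t) - (nu A B C + 1 / 2) * ln (Tm t)).
Proof.
  intros hA q Tp Tm t [hD [hp hm]].
  destruct (sqrt_pow2_pos A hA) as [hq hqq]. fold q in hq, hqq.
  fold (Tp t) in hp. fold (Tm t) in hm.
  assert (dp : is_derive Tp t (2 * q * (Tp t - alpha - 1))).
  { unfold Tp, Tplus, q. auto_derive; [trivial |]. ring. }
  assert (dm : is_derive Tm t (- 2 * q * (Tm t - beta - 1))).
  { unfold Tm, Tminus, q. auto_derive; [trivial |]. ring. }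
  assert (rel : Tp t * Tm t + (alpha + beta + 1)
                = (beta + 1) * Tp t + (alpha + 1) * Tm t).
  { unfold Tp, Tm, Tplus, Tminus. destruct (exp_double (sqrt A) t) as [e1 [e2 _]].
    rewrite e1, e2. field. apply Rgt_not_eq, exp_pos. }
  assert (hpm : 0 < Tp t * Tm t) by (apply Rmult_lt_0_compat; assumption).
  assert (hD2 := sqrt_pow2_pos _ hD). assert (hpm2 := sqrt_pow2_pos _ hpm).
  assert (np : Tp t <> 0) by lra. assert (nm : Tm t <> 0) by lra.
  assert (nq : q <> 0) by lra.
  assert (dT : is_derive (T1 A alpha beta) t ((alpha + beta + 1) / (Tp t * Tm t))).
  { change (is_derive (fun t => t + ln (Tm t / Tp t) / (2 * q)) t
      ((alpha + beta + 1) / (Tp t * Tm t))).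
    clearbody Tp Tm. auto_derive.
    - repeat split; try (eexists; eassumption); try lra.
      apply Rdiv_lt_0_compat; assumption.
    - known_derive.
      replace (alpha + beta + 1)
        with ((beta + 1) * Tp t + (alpha + 1) * Tm t - Tp t * Tm t) by lra.
      field. repeat split; assumption. }
  assert (sg2 : (sqrt (alpha + beta + 1) / sqrt (Tp t * Tm t)) ^ 2
    = (alpha + beta + 1) / (Tp t * Tm t)).
  { destruct hD2 as [_ e1], hpm2 as [e0 e2]. unfold Rdiv.
    rewrite Rpow_mult_distr, e1, pow_inv, e2. reflexivity. }
  clearbody Tp Tm.
  split; [| split; [| split; [| split; [| split]]]].
  - rewrite sg2. exact dT.
  - destruct hpm2 as [e0 e2].
    assert (es : is_derive (fun t => sqrt (Tp t * Tm t)) t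
      (q * ((beta + 1) * Tp t - (alpha + 1) * Tm t) / sqrt (Tp t * Tm t))).
    { auto_derive; [repeat split; try (eexists; eassumption); exact hpm |].
      known_derive. field. lra. }
    set (r := fun t => sqrt (Tp t * Tm t)) in *.
    match type of es with is_derive _ _ ?l => change (is_derive r t l) in es end.
    change (is_derive (fun t => sqrt (alpha + beta + 1) / r t) t
      (2 * (- q * ((beta + 1) * Tp t - (alpha + 1) * Tm t) / (2 * Tp t * Tm t))
       * (sqrt (alpha + beta + 1) / r t))).
    change (sqrt (Tp t * Tm t)) with (r t) in *. clearbody r.
    derive; [lra |].
    replace (2 * Tp t * Tm t) with (2 * r t ^ 2) by lra. field. lra.
  - auto_derive; [trivial | ring].
  - replace ((sqrt (alpha + beta + 1) / sqrt (Tp t * Tm t)) ^ 4)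
      with (((alpha + beta + 1) / (Tp t * Tm t)) ^ 2) by (rewrite <- sg2; ring).
    auto_derive.
    + repeat split; try (eexists; eassumption).
      repeat apply Rmult_integral_contrapositive_currified; auto; lra.
    + known_derive. rewrite <- hqq.
      replace (alpha + beta + 1)
        with ((beta + 1) * Tp t + (alpha + 1) * Tm t - Tp t * Tm t) by lra.
      field. split; assumption.
  - auto_derive; [trivial | ring].
  - auto_derive.
    + repeat split; try (eexists; eassumption); assumption.
    + known_derive. rewrite sg2. unfold nu. fold q. rewrite <- hqq.
      replace (alpha + beta + 1)
        with ((beta + 1) * Tp t + (alpha + 1) * Tm t - Tp t * Tm t) by lra.
      field. repeat split; assumption.
Qed.

Lemma s1_multiplier (A B C : R) (theta : R -> R) (alpha beta x t : R) :
  multiplier (s1 A B C theta alpha beta) x t =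
  theta x / theta (X1 A B alpha beta x t) *
  exp (- sqrt A * ((beta + 1) * Tplus A alpha beta t
                   - (alpha + 1) * Tminus A alpha beta t)
         / (2 * Tplus A alpha beta t * Tminus A alpha beta t) * (x + 2 * B / A) ^ 2
       + (nu A B C * ln (Tplus A alpha beta t)
          - (nu A B C + 1 / 2) * ln (Tminus A alpha beta t))).
Proof.
  simpl. f_equal. unfold Rpower. rewrite <- exp_plus. unfold Rdiv at 1.
  rewrite <- exp_Ropp, <- exp_plus. f_equal. unfold Rdiv. ring.
Qed.

Lemma s2_multiplier (A B : R) (theta : R -> R) (alpha beta x t : R) :
  let w := exp (sqrt A * t) in
  multiplier (s2 A B theta alpha beta) x t =
  theta x / theta (X2 A alpha beta x t) *
  exp (- (sqrt A / 2) * (alpha * w - beta / w)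
       * (2 * (x + 2 * B / A) - alpha * w - beta / w)).
Proof.
  intros w. simpl. f_equal. unfold Rdiv at 1. rewrite <- exp_Ropp, <- exp_plus.
  f_equal. unfold X2. destruct (exp_double (sqrt A) t) as [_ [_ e]].
  rewrite e. fold w. unfold Rdiv. ring.
Qed.

Lemma letter_symmetry (A B C : R) (theta : R -> R) (a b : Rbar) (l : letter) :
  0 < A -> theta_equation A B C theta ->
  (forall x, between a b x -> theta x <> 0) ->
  symmetry_on theta (between a b) (letter_dom A B C theta (between a b) l)
    (letter_transf A B C theta l).
Proof.
  intros hA hth h0. destruct l as [alpha beta | alpha beta].
  - apply (oscillator_symmetry_on A B C theta a b (letter_time A (L1 alpha beta))
      _ _ _ _ _ _ (s1 A B C theta alpha beta) hA hth h0) with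
      (2 := s1_preserves_oscillator A B C alpha beta hA).
    + intros t [hD [hp hm]].
      assert (c : forall f : R -> R, ex_derive f t -> 0 < f t ->
        locally t (fun t => 0 < f t)).
      { intros f [m hf] hpos. apply (is_derive_continuous f t m hf).
        apply open_gt, hpos. }
      assert (lp := c (Tplus A alpha beta) ltac:(unfold Tplus; auto_derive; trivial) hp).
      assert (lm := c (Tminus A alpha beta) ltac:(unfold Tminus; auto_derive; trivial) hm).
      generalize (filter_and _ _ lp lm). apply filter_imp.
      intros s [hps hms]. repeat split; assumption.
    + reflexivity.
    + intros x t. simpl. unfold X1. unfold Rdiv. ring.
    + intros x t _. rewrite s1_multiplier.
      apply f_equal, f_equal. ring.
  - apply (oscillator_symmetry_on A B C theta a b (fun _ => True)
      _ _ _ _ _ _ (s2 A B theta alpha beta) hA hth h0) with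
      (2 := s2_preserves_oscillator A (2 * B ^ 2 / A - C) alpha beta hA).
    + intros t _. apply filter_forall. trivial.
    + reflexivity.
    + intros x t. simpl. unfold X2. ring.
    + intros x t _. rewrite s2_multiplier.
      apply f_equal, f_equal. destruct (exp_double (sqrt A) t) as [_ [_ e]].
      rewrite e. field. split; [apply Rgt_not_eq, exp_pos | lra].
Qed.

(** * Matching with a word in the explicit families *)

(** A word for [g]: the Moebius part in [s1], the shift in [s2], and a commutator of
    two shifts, whose only effect is the constant [exp (- sqrt A * kappa)]. *)
Definition canonical_word (A : R) (g : oscillator_map) : list letter :=
  let l0 := e21 g + e22 g in
  let kappa := (ln l0 / 2 - log_scale g) / sqrt A in
  L1 (- e12 g / l0) (- e21 g / l0) :: L2 (shift_p g) (shift_q g)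
  :: L2 1 0 :: L2 0 kappa :: L2 (-1) (- kappa) :: nil.

(** The hypothesis on the row sums says that the Moebius map fixes [1], that is
    [T 0 = 0]; it makes the normalisation of the matrix by [l0] the one of [s1]. *)
Lemma carries_s1 (A B : R) (g : oscillator_map) (x0 t0 x t : R) :
  0 < A -> unimodular g ->
  e11 g + e12 g = e21 g + e22 g -> 0 < e21 g + e22 g ->
  carries A B g x0 t0 x t ->
  let l0 := e21 g + e22 g in
  let l := projective_factor A g t0 in
  let w0 := exp (sqrt A * t0) in
  let w := exp (sqrt A * t) in
  let alpha := - e12 g / l0 in
  let beta := - e21 g / l0 in
  alpha + beta + 1 = / l0 ^ 2 /\
  Tplus A alpha beta t = / (l * l0) /\
  Tminus A alpha beta t = w0 ^ 2 / (w ^ 2 * l * l0) /\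
  T1 A alpha beta t = t0 /\
  X1 A B alpha beta x t = l * w * (x + 2 * B / A) / w0 - 2 * B / A.
Proof.
  intros hA hu hsum hl0 [hl [hp hr]] l0 l w0 w alpha beta.
  destruct (sqrt_pow2_pos A hA) as [hq _].
  fold l in hl. fold w0 in hp, hr. fold w in hp, hr. fold l in hp, hr. fold l0 in hl0.
  assert (hw0 : 0 < w0) by apply exp_pos. assert (hw : 0 < w) by apply exp_pos.
  assert (El : l = e21 g * w0 ^ 2 + e22 g) by reflexivity.
  unfold unimodular in hu.
  assert (E12 : e12 g = l0 - e11 g) by (unfold l0; lra).
  assert (E22 : e22 g = l0 - e21 g) by (unfold l0; lra).
  assert (Edet : l0 * (e11 g - e21 g) = 1).
  { rewrite <- hu, E12, E22. ring. }
  assert (ED : alpha + beta + 1 = / l0 ^ 2).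
  { apply (Rmult_eq_reg_r (l0 ^ 2)); [| apply pow_nonzero; lra].
    rewrite Rinv_l; [| apply pow_nonzero; lra].
    transitivity (l0 * (e11 g - e21 g)); [| exact Edet].
    unfold alpha, beta. rewrite E12. field. lra. }
  assert (hdet : l * (w ^ 2 * e22 g - e12 g) = w0 ^ 2).
  { replace (l * (w ^ 2 * e22 g - e12 g))
      with (l * w ^ 2 * e22 g - l * e12 g) by ring.
    rewrite <- hp, El.
    replace ((e11 g * w0 ^ 2 + e12 g) * e22 g - (e21 g * w0 ^ 2 + e22 g) * e12 g)
      with (w0 ^ 2 * (e11 g * e22 g - e12 g * e21 g)) by ring.
    rewrite hu. ring. }
  assert (hdet' : l * (e11 g - e21 g * w ^ 2) = 1).
  { replace (l * (e11 g - e21 g * w ^ 2)) with (l * e11 g - e21 g * (l * w ^ 2)) by ring.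
    transitivity (e11 g * e22 g - e12 g * e21 g); [| exact hu].
    rewrite <- hp, El. ring. }
  destruct (exp_double (sqrt A) t) as [x1 [x2 _]]. fold w in x1, x2.
  assert (EP : Tplus A alpha beta t = / (l * l0)).
  { unfold Tplus. rewrite x1. apply (Rmult_eq_reg_r (l * l0)).
    - rewrite Rinv_l; [| apply Rgt_not_eq, Rmult_lt_0_compat; assumption].
      transitivity (l * (e11 g - e21 g * w ^ 2)); [| exact hdet'].
      unfold alpha, beta. rewrite E12. field. lra.
    - apply Rgt_not_eq, Rmult_lt_0_compat; assumption. }
  assert (EM : Tminus A alpha beta t = w0 ^ 2 / (w ^ 2 * l * l0)).
  { unfold Tminus. rewrite x2, <- hdet. unfold alpha, beta. rewrite E22. field.
    repeat split; lra. }
  split; [exact ED | split; [exact EP | split; [exact EM | split]]].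
  - unfold T1. rewrite EP, EM.
    replace (w0 ^ 2 / (w ^ 2 * l * l0) / / (l * l0))
      with (exp (2 * sqrt A * (t0 - t))).
    + rewrite ln_exp. field. lra.
    + replace (2 * sqrt A * (t0 - t)) with (2 * sqrt A * t0 + (- 2 * sqrt A * t)) by ring.
      rewrite exp_plus, x2. destruct (exp_double (sqrt A) t0) as [x3 _].
      rewrite x3. fold w0. field. repeat split; lra.
  - unfold X1. rewrite ED, EP, EM.
    replace (/ l0 ^ 2) with ((/ l0) ^ 2) by (field; lra).
    replace (/ (l * l0) * (w0 ^ 2 / (w ^ 2 * l * l0)))
      with ((w0 / (w * l * l0)) ^ 2) by (field; repeat split; lra).
    rewrite !sqrt_pow2.
    + field. repeat split; lra.
    + left. apply Rdiv_lt_0_compat; [exact hw0 |].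
      repeat apply Rmult_lt_0_compat; assumption.
    + left. apply Rinv_0_lt_compat, hl0.
Qed.

(** The factors [theta (.)] telescope where the intermediate points avoid the zeros
    of [theta]; what remains is an identity between the logarithm of the product and
    [log_multiplier], in which [s1] contributes [ln l0 / 2] and the three last
    letters together [- sqrt A * kappa]. *)
Lemma canonical_word_represents (A B C : R) (theta : R -> R) (g : oscillator_map)
  (x0 t0 x t : R) :
  0 < A -> unimodular g ->
  e11 g + e12 g = e21 g + e22 g -> 0 < e21 g + e22 g ->
  carries A B g x0 t0 x t -> theta x0 <> 0 ->
  let word := canonical_word A g in
  word_time A B C theta word t /\
  t0 = time (word_transf A B C theta word) t /\
  x0 = space (word_transf A B C theta word) x t /\
  (word_regular A B C theta word x t ->
   full_multiplier A B C theta g x0 t0 x t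
   = multiplier (word_transf A B C theta word) x t).
Proof.
  intros hA hu hsum hl0 hcar hx0 word.
  destruct (carries_s1 A B g x0 t0 x t hA hu hsum hl0 hcar) as [ED [EP [EM [ET EX]]]].
  destruct hcar as [hl [hp hr]].
  destruct (sqrt_pow2_pos A hA) as [hq hqq].
  unfold word, canonical_word. clear word.
  unfold full_multiplier, log_multiplier.
  set (l0 := e21 g + e22 g) in *. set (l := projective_factor A g t0) in *.
  set (w0 := exp (sqrt A * t0)) in *. set (w := exp (sqrt A * t)) in *.
  set (alpha := - e12 g / l0) in *. set (beta := - e21 g / l0) in *.
  set (kappa := (ln l0 / 2 - log_scale g) / sqrt A).
  assert (hw0 : 0 < w0) by apply exp_pos. assert (hw : 0 < w) by apply exp_pos.
  set (h := 2 * B / A) in *. set (y := x + h) in *.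
  set (x1 := l * w * y / w0 - h) in *.
  assert (E2 : forall a b z, X2 A a b z t0 = z - a * w0 - b / w0).
  { intros a b z. unfold X2. destruct (exp_double (sqrt A) t0) as [_ [_ e]].
    rewrite e. fold w0. unfold Rdiv. ring. }
  assert (Ey0 : x0 + h = l * w * y / w0 - shift_p g * w0 - shift_q g / w0).
  { apply (Rmult_eq_reg_l w0); [| lra].
    transitivity (l * w * y - shift_p g * w0 ^ 2 - shift_q g); [lra |]. field. lra. }
  assert (F1 : X2 A (shift_p g) (shift_q g) x1 t0 = x0).
  { rewrite E2. unfold x1. lra. }
  set (x3 := X2 A 1 0 x0 t0). set (x4 := X2 A 0 kappa x3 t0).
  assert (F3 : x3 = x0 - w0) by (unfold x3; rewrite E2; unfold Rdiv; ring).
  assert (F4 : x4 = x0 - w0 - kappa / w0).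
  { unfold x4. rewrite E2, F3. ring. }
  assert (F5 : X2 A (-1) (- kappa) x4 t0 = x0).
  { rewrite E2, F4. field. lra. }
  split; [| split; [| split]].
  - split; [| repeat split].
    split; [| split].
    + rewrite ED. apply Rinv_0_lt_compat, pow_lt, hl0.
    + rewrite EP. apply Rinv_0_lt_compat, Rmult_lt_0_compat; assumption.
    + rewrite EM. apply Rdiv_lt_0_compat; [apply pow_lt, hw0 |].
      apply Rmult_lt_0_compat; [| exact hl0].
      apply Rmult_lt_0_compat; [apply pow_lt, hw | exact hl].
  - symmetry. exact ET.
  - change (x0 = X2 A (-1) (- kappa) (X2 A 0 kappa (X2 A 1 0
      (X2 A (shift_p g) (shift_q g) (X1 A B alpha beta x t) (T1 A alpha beta t))
      (T1 A alpha beta t)) (T1 A alpha beta t)) (T1 A alpha beta t)).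
    rewrite EX, ET, F1. fold x3. fold x4. rewrite F5. reflexivity.
  - intros [r1 [_ [r3 [r4 _]]]].
    change (theta (X1 A B alpha beta x t) <> 0) in r1.
    change (theta (X2 A 1 0 (X2 A (shift_p g) (shift_q g) (X1 A B alpha beta x t)
      (T1 A alpha beta t)) (T1 A alpha beta t)) <> 0) in r3.
    change (theta (X2 A 0 kappa (X2 A 1 0 (X2 A (shift_p g) (shift_q g)
      (X1 A B alpha beta x t) (T1 A alpha beta t)) (T1 A alpha beta t))
      (T1 A alpha beta t)) <> 0) in r4.
    rewrite EX, ET, F1 in r3, r4. rewrite EX in r1. fold x3 in r3, r4. fold x4 in r4.
    set (M := fun a b => multiplier (s2 A B theta a b)).
    match goal with |- ?lhs = _ => change (lhs =
      multiplier (s1 A B C theta alpha beta) x t *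
      (M (shift_p g) (shift_q g) (X1 A B alpha beta x t) (T1 A alpha beta t) *
      (M 1 0 (X2 A (shift_p g) (shift_q g) (X1 A B alpha beta x t)
        (T1 A alpha beta t)) (T1 A alpha beta t) *
      (M 0 kappa (X2 A 1 0 (X2 A (shift_p g) (shift_q g) (X1 A B alpha beta x t)
        (T1 A alpha beta t)) (T1 A alpha beta t)) (T1 A alpha beta t) *
      (M (-1) (- kappa) (X2 A 0 kappa (X2 A 1 0 (X2 A (shift_p g) (shift_q g)
        (X1 A B alpha beta x t) (T1 A alpha beta t)) (T1 A alpha beta t))
        (T1 A alpha beta t)) (T1 A alpha beta t) * 1))))) end.
    rewrite EX, ET, F1. fold x3. fold x4. unfold M.
    rewrite s1_multiplier, !s2_multiplier, EX, F1. fold x3. fold x4.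
    rewrite F5. fold h. fold w0. fold y.
    transitivity (theta x / theta x0 * (exp
      (- sqrt A * ((beta + 1) * Tplus A alpha beta t
         - (alpha + 1) * Tminus A alpha beta t)
         / (2 * Tplus A alpha beta t * Tminus A alpha beta t) * y ^ 2
       + (nu A B C * ln (Tplus A alpha beta t)
          - (nu A B C + 1 / 2) * ln (Tminus A alpha beta t))) *
      (exp (- (sqrt A / 2) * (shift_p g * w0 - shift_q g / w0)
            * (2 * (x1 + h) - shift_p g * w0 - shift_q g / w0)) *
      (exp (- (sqrt A / 2) * (1 * w0 - 0 / w0)
            * (2 * (x0 + h) - 1 * w0 - 0 / w0)) *
      (exp (- (sqrt A / 2) * (0 * w0 - kappa / w0)
            * (2 * (x3 + h) - 0 * w0 - kappa / w0)) *
      (exp (- (sqrt A / 2) * (-1 * w0 - - kappa / w0)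
            * (2 * (x4 + h) - -1 * w0 - - kappa / w0)))))))).
    2: { field. repeat split; assumption. }
    f_equal. rewrite <- !exp_plus. f_equal.
    assert (LP : ln (Tplus A alpha beta t) = - ln l - ln l0).
    { rewrite EP, ln_Rinv, ln_mult; try assumption; [ring |].
      apply Rmult_lt_0_compat; assumption. }
    assert (LM : ln (Tminus A alpha beta t)
                 = 2 * sqrt A * (t0 - t) - ln l - ln l0).
    { replace (Tminus A alpha beta t)
        with (exp (2 * sqrt A * (t0 - t)) * / (l * l0)).
      - rewrite ln_mult, ln_exp, ln_Rinv, ln_mult; try assumption; try ring.
        + apply Rmult_lt_0_compat; assumption.
        + apply exp_pos.
        + apply Rinv_0_lt_compat, Rmult_lt_0_compat; assumption.
      - rewrite EM.
        replace (2 * sqrt A * (t0 - t))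
          with (2 * sqrt A * t0 + (- 2 * sqrt A * t)) by ring.
        destruct (exp_double (sqrt A) t0) as [e1 _].
        destruct (exp_double (sqrt A) t) as [_ [e2 _]].
        rewrite exp_plus, e1, e2. fold w0. fold w. field. repeat split; lra. }
    rewrite LP, LM, EP, EM.
    assert (hk : sqrt A * kappa = ln l0 / 2 - log_scale g).
    { unfold kappa. field. lra. }
    assert (Ec : log_scale g = ln l0 / 2 - sqrt A * kappa) by lra.
    assert (Ex0 : x0 = l * w * y / w0 - shift_p g * w0 - shift_q g / w0 - h) by lra.
    rewrite Ec, F3, F4, Ex0. unfold x1.
    assert (Ea : alpha + 1 = e11 g / l0).
    { unfold alpha. replace (e12 g) with (l0 - e11 g) by lra. field. lra. }
    assert (Eb : beta + 1 = e22 g / l0).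
    { unfold beta. replace (e21 g) with (l0 - e22 g) by (unfold l0; ring).
      field. lra. }
    rewrite Ea, Eb.
    assert (H11 : e11 g = (l * w ^ 2 - e12 g) / w0 ^ 2).
    { rewrite <- hp. field. lra. }
    assert (H22 : e22 g = (w0 ^ 2 / l + e12 g) / w ^ 2).
    { apply (Rmult_eq_reg_r (l * w ^ 2));
        [| apply Rgt_not_eq, Rmult_lt_0_compat; [exact hl | apply pow_lt, hw]].
      transitivity (w0 ^ 2 + l * e12 g); [| field; lra].
      transitivity (w0 ^ 2 * (e11 g * e22 g - e12 g * e21 g) + l * e12 g);
        [| rewrite hu; ring].
      rewrite <- hp. unfold l, projective_factor. fold w0. ring. }
    rewrite H11, H22. unfold nu.
    generalize (ln l), (ln l0), (e12 g), (shift_p g), (shift_q g). intros.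
    clear - hl hl0 hw hw0 hq hA. clearbody kappa l l0 w w0 y h.
    field. repeat split; lra.
Qed.

(** * Classification *)

Lemma strip_open (a b : Rbar) :
  open_in_strip (between a b) (fun p : R * R => between a b (fst p)).
Proof.
  split; [| auto]. intros [x t] hx.
  exact (continuous_fst x t (between a b) (locally_between a b x hx)).
Qed.

Lemma zero_solution (A B C : R) (theta : R -> R) (a b : Rbar) :
  theta_equation A B C theta -> (forall x, between a b x -> theta x <> 0) ->
  solution_on theta (fun p => between a b (fst p)) (fun _ _ => 0).
Proof.
  intros hth h0.
  apply (c21_solution A B C theta a b _ _ (fun _ _ => 0) (fun _ _ => 0) (fun _ _ => 0)
    hth h0 (strip_open a b)).
  - intros x t _. repeat (split; [first [apply continuous2_const
      | apply (is_derive_const (K := R_AbsRing) (V := R_NormedModule) 0)] |]).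
    apply continuous2_const.
  - intros x t _. ring.
Qed.

(** The invariant density of the diffusion. *)
Lemma theta_square_solution (A B C : R) (theta : R -> R) (a b : Rbar) :
  theta_equation A B C theta -> (forall x, between a b x -> theta x <> 0) ->
  solution_on theta (fun p => between a b (fst p)) (fun x _ => theta x * theta x).
Proof.
  intros hth h0.
  assert (h := c21_theta A B C theta (fun p => between a b (fst p)) hth).
  apply (c21_solution A B C theta a b _ _ _ _ _ hth h0 (strip_open a b)
    (c21_mult _ _ _ _ _ _ _ _ _ h h)).
  intros x t hx. cbv beta. unfold drift. field. apply h0, hx.
Qed.

(** The Moebius map comes from the exponentials alone, so that one word serves all
    points of [D], whatever its connected components. *)
Lemma lie_symmetry_word (A B C : R) (theta : R -> R) (a b : Rbar)
  (D : R * R -> Prop) (f X : R -> R -> R) (T : R -> R) (x0 : R) :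
  0 < A -> theta_equation A B C theta ->
  (forall x, between a b x -> theta x <> 0) ->
  lie_symmetry_on theta (between a b) D (Transf f X T) ->
  D (x0, 0) -> T 0 = 0 ->
  exists w : list letter,
    w <> nil /\
    forall x t, D (x, t) ->
      word_time A B C theta w t /\
      T t = time (word_transf A B C theta w) t /\
      X x t = space (word_transf A B C theta w) x t /\
      (word_regular A B C theta w x t ->
       f x t = multiplier (word_transf A B C theta w) x t).
Proof.
  intros hA hth h0 [[hD _] [vs [hvs hexp]]] hx0 hT.
  simpl in hD, hexp.
  destruct (exps_map_carries A B C theta a b vs identity_map x0 hA hth h0
    (proj1 (hD x0 0 hx0)) hvs ltac:(unfold unimodular; simpl; ring)) as [g [hu hg]].
  assert (H0 := hexp _ _ (strip_open a b) (zero_solution A B C theta a b hth h0)).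
  assert (H1 := hexp _ _ (strip_open a b) (theta_square_solution A B C theta a b hth h0)).
  (* the zero solution and [theta ^ 2] give two curves whose difference isolates
     the multiplier from the inhomogeneous term *)
  assert (hcar : forall x t, D (x, t) ->
    carries A B g (X x t) (T t) x t /\
    f x t = full_multiplier A B C theta g (X x t) (T t) x t).
  { intros x t hx. destruct (hD x t hx) as [hIx hIX].
    destruct (hg (X x t) (T t) (X x t) (T t) 0 (theta (X x t) * theta (X x t))
      x t _ x t _ (h0 _ hIX) (carries_identity A B (X x t) (T t))
      (H0 x t hx hIX) (H1 x t hx hIX)) as [hc E].
    split; [exact hc |]. unfold Defs.apply in E. simpl in E.
    assert (I1 : full_multiplier A B C theta identity_map (X x t) (T t) (X x t) (T t) = 1).
    { unfold full_multiplier, log_multiplier, projective_factor; simpl.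
      rewrite Rmult_0_l, Rplus_0_l, ln_1.
      match goal with |- _ * exp ?z = 1 => replace z with 0 end.
      - rewrite exp_0. field. apply h0, hIX.
      - field. split; [lra | apply Rgt_not_eq, exp_pos]. }
    rewrite I1 in E.
    assert (hm : full_multiplier A B C theta g (X x t) (T t) x t <> 0).
    { unfold full_multiplier. apply Rmult_integral_contrapositive_currified.
      - apply Rmult_integral_contrapositive_currified;
          [apply h0, hIx | apply Rinv_neq_0_compat, h0, hIX].
      - apply Rgt_not_eq, exp_pos. }
    assert (hX := h0 _ hIX).
    set (m := full_multiplier A B C theta g (X x t) (T t) x t) in *.
    apply (Rmult_eq_reg_r (theta (X x t) * theta (X x t)));
      [| apply Rmult_integral_contrapositive_currified; exact hX].
    transitivity (m * ((f x t * (theta (X x t) * theta (X x t)) - f x t * 0) / m));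
      [field; exact hm |].
    rewrite E. field. }
  destruct (hcar x0 0 hx0) as [[hl [hp _]] _].
  rewrite hT in hl, hp. unfold projective_factor in hl, hp.
  rewrite Rmult_0_r, exp_0, pow1, !Rmult_1_r in hp.
  rewrite Rmult_0_r, exp_0, pow1, !Rmult_1_r in hl.
  exists (canonical_word A g). split; [discriminate |].
  intros x t hx. destruct (hD x t hx) as [_ hIX]. destruct (hcar x t hx) as [hc ->].
  apply canonical_word_represents; auto.
Qed.

Theorem proposition3p6 (A B C : R) (theta : R -> R) (a b : Rbar)
  (hA : 0 < A)
  (htheta : theta_equation A B C theta)
  (hab : forall x, between a b x -> theta x <> 0) :
  (forall l : letter,
     symmetry_on theta (between a b) (letter_dom A B C theta (between a b) l)
       (letter_transf A B C theta l)) /\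
  (forall (D : R * R -> Prop) (f X : R -> R -> R) (T : R -> R),
     open D ->
     lie_symmetry_on theta (between a b) D (Transf f X T) ->
     (exists x0, D (x0, 0)) ->
     T 0 = 0 ->
     exists w : list letter,
       w <> nil /\
       forall x t, D (x, t) ->
         word_time A B C theta w t /\
         T t = time (word_transf A B C theta w) t /\
         X x t = space (word_transf A B C theta w) x t /\
         (word_regular A B C theta w x t ->
          f x t = multiplier (word_transf A B C theta w) x t)).
Proof.
  split.
  - intros l. apply letter_symmetry; assumption.
  - intros D f X T _ hlie [x0 hx0] hT.
    apply (lie_symmetry_word A B C theta a b D f X T x0); assumption.
Qed.
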